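(* Let $L>0$. Then, as $n\to\infty$, the functionals $L^{\frac{n-2}{n}}\left(\mathcal{E}_n^n\right)^{\frac1n}$ $\Gamma$-converge to the ropelength functional $\mathcal{R}$ on the metric space $\left(C^{1,1}_{\mathrm{ia}}(\mathbb{R}/L\mathbb{Z},\mathbb{R}^3),\|\cdot\|_{C^1}\right)$.
   Context: $C^{1,1}_{\mathrm{ia}}(\mathbb{R}/L\mathbb{Z},\mathbb{R}^3)$ is the set of closed $C^{1,1}$-curves $\gamma:\mathbb{R}/L\mathbb{Z}\to\mathbb{R}^3$ that are injective and parametrized by arclength ($|\gamma'|\equiv 1$, so the length is $L$); here it carries the metric induced by the $C^1$-norm. Ropelength: $\mathcal{R}(\gamma)=L/\triangle[\gamma]$ for an arclength parametrized $\gamma$ on $\mathbb{R}/L\mathbb{Z}$, where the thickness is $\triangle[\gamma]=\inf_{s\ne t\ne\tau\ne s}R(\gamma(s),\gamma(t),\gamma(\tau))$ and $R(x,y,z)$ is the circumcircle radius of $x,y,z\in\mathbb{R}^3$. Biarcs: a biarc is a pair of circular arcs in $\mathbb{R}^3$ (straight segments allowed as degenerate arcs), joined continuously with continuous tangent, interpolating a point-tangent pair $([q_0,t_0],[q_1,t_1])$ with $q_0,q_1\in\mathbb{R}^3$, $q_0\ne q_1$, and unit vectors $t_0,t_1\in\mathbb{S}^2$: it runs from $q_0$ with tangent $t_0$ to $q_1$ with tangent $t_1$ (with orientation). A closed biarc curve consisting of $n$ biarcs is a closed curve assembled in a $C^1$-fashion from $n$ consecutive biarcs interpolating data $[q_0,t_0],\dots,[q_n,t_n]$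 with $[q_n,t_n]=[q_0,t_0]$, where the $i$-th biarc ($i=0,\dots,n-1$) interpolates $([q_i,t_i],[q_{i+1},t_{i+1}])$ and has length $\lambda_i$. A biarc curve is understood together with its decomposition into biarcs; the points $q_i$ and unit tangents $t_i$ are those at the junctions of consecutive biarcs. Let $\mathcal{B}_n$ be the class of closed biarc curves $\beta$ consisting of $n$ biarcs such that, with $\mathscr{L}(\beta)$ the length of $\beta$, $$\frac{\mathscr{L}(\beta)}{2n}\le\lambda_i\le\frac{2\mathscr{L}(\beta)}{n}\quad\text{for } i=0,\dots,n-1 .$$ Discrete tangent-point energy (parameter invariant): for $n\in\mathbb{N}$, $q\in[2,\infty)$ and a closed $C^1$-curve $\gamma$, $$\mathcal{E}_q^n(\gamma)=\sum_{i=0}^{n-1}\sum_{j=0,\,j\ne i}^{n-1}\left(\frac{2\,\mathrm{dist}(l(q_j),q_i)}{|q_i-q_j|^2}\right)^q\lambda_i\lambda_j\ \text{ if }\gamma\in\mathcal{B}_n,\qquad \mathcal{E}_q^n(\gamma)=\infty\ \text{ otherwise},$$ where $l(q_j)=q_j+\mathbb{R}t_j$. The functional $\mathcal{E}_n^n$ is $\mathcal{E}_q^n$ with exponent $q=n$ ($n\ge 2$). $\Gamma$-convergence of $\mathcal{F}_n$ to $\mathcal{F}$ on a metric space $X$ means: (liminf) for all $x_n\to x$ in $X$, $\mathcal{F}(x)\le\liminf_{n\to\infty}\mathcal{F}_n(x_n)$; (limsup) for every $x\in X$ there is a sequence $x_n\to x$ in $X$ with $\limsup_{n\to\infty}\mathcal{F}_n(x_n)\le\mathcal{F}(x)$.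 *)

(* Defs.v *)
From HB Require Import structures.
From mathcomp Require Import all_boot all_order all_algebra.
From mathcomp Require Import all_classical all_reals all_analysis.
From mathcomp Require Import ring lra.

Set Implicit Arguments.
Unset Strict Implicit.
Unset Printing Implicit Defensive.

Import Order.TTheory GRing.Theory Num.Theory.
Import numFieldNormedType.Exports.

Local Open Scope classical_set_scope.
Local Open Scope ring_scope.

Section Euclidean.
Context {R : realType}.
Implicit Types u v p : 'rV[R]_3.

Definition dotv u v : R := \sum_(i < 3) u 0 i * v 0 i.

(* The norm that MathComp-Analysis puts on 'rV[R]_3 is the sup norm, so the
   Euclidean one is introduced separately. *)
Definition enorm u : R := Num.sqrt (dotv u u).

Definition orthonormal_pair u v : Prop :=
  [/\ enorm u = 1, enorm v = 1 & dotv u v = 0].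

Definition dist_line p (w q : 'rV[R]_3) : R :=
  inf [set enorm (q - (p + tau *: w)) | tau in [set: R]].

Lemma dotvE u v : dotv u v =
  u 0 0 * v 0 0 + u 0 1 * v 0 1 + u 0 (2%:R : 'I_3) * v 0 (2%:R : 'I_3).
Proof.
rewrite /dotv !big_ord_recr big_ord0 /= add0r.
congr (_ * _ + _ * _ + _ * _); congr (_ 0 _); exact: val_inj.
Qed.

Lemma dotv_ge0 u : 0 <= dotv u u.
Proof. by apply: sumr_ge0 => i _; rewrite -expr2 sqr_ge0. Qed.

Lemma enorm_ge0 u : 0 <= enorm u. Proof. exact: sqrtr_ge0. Qed.

Lemma enorm0 : enorm 0 = 0.
Proof. by rewrite /enorm /dotv big1 ?sqrtr0// => i _; rewrite mxE mul0r. Qed.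

Lemma enorm_eq0 u : enorm u = 0 -> u = 0.
Proof.
move=> /eqP; rewrite sqrtr_eq0 => u0.
have : dotv u u == 0 by rewrite eq_le u0 dotv_ge0.
rewrite psumr_eq0 => [|i _]; last by rewrite -expr2 sqr_ge0.
move=> /allP uu0; apply/rowP => i.
have := uu0 i (mem_index_enum _).
by rewrite -expr2 sqrf_eq0 => /eqP ->; rewrite mxE.
Qed.

Lemma enormN u : enorm (- u) = enorm u.
Proof.
by congr Num.sqrt; apply: eq_bigr => i _; rewrite !mxE mulrNN.
Qed.

Lemma dotv_le u v : dotv u v <= enorm u * enorm v.
Proof.
rewrite -sqrtrM ?dotv_ge0//; apply: (le_trans (ler_norm _)).
rewrite -sqrtr_sqr ler_sqrt; last by rewrite mulr_ge0// dotv_ge0.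
rewrite !dotvE; set a := u 0 0; set b := u 0 1; set c := u 0 _.
set x := v 0 0; set y := v 0 1; set z := v 0 _.
rewrite -subr_ge0.
have -> : (a * a + b * b + c * c) * (x * x + y * y + z * z)
          - (a * x + b * y + c * z) ^+ 2 =
  (a * y - b * x) ^+ 2 + (b * z - c * y) ^+ 2 + (a * z - c * x) ^+ 2 by ring.
by rewrite !addr_ge0// sqr_ge0.
Qed.

Lemma enorm_triangle u v : enorm (u + v) <= enorm u + enorm v.
Proof.
rewrite -(@ler_pXn2r _ 2)// ?nnegrE ?addr_ge0 ?enorm_ge0//.
rewrite {1}/enorm sqr_sqrtr ?dotv_ge0//.
have -> : dotv (u + v) (u + v) = enorm u ^+ 2 + enorm v ^+ 2 + dotv u v *+ 2.
  by rewrite /enorm !sqr_sqrtr ?dotv_ge0// !dotvE !mxE; ring.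
rewrite sqrrD (addrAC (enorm u ^+ 2)) lerD2r lerD2l lerMn2r.
exact: dotv_le.
Qed.

End Euclidean.

Section C1norm.
Context {R : realType}.
Implicit Types f g : R -> 'rV[R]_3.

Definition supnorm f : R := sup [set enorm (f t) | t in [set: R]].

Definition C1norm f : R := supnorm f + supnorm (derive1 f).

Definition ebounded f := exists M, forall t, enorm (f t) <= M.

Lemma supnorm_ub f t : ebounded f -> enorm (f t) <= supnorm f.
Proof.
move=> [M fM]; apply: ub_le_sup; last by exists t.
by exists M => _ [s _ <-].
Qed.

Lemma supnorm_le f (M : R) : (forall t, enorm (f t) <= M) -> supnorm f <= M.
Proof.
move=> fM; apply: ge_sup => [|_ [t _ <-]//].
by exists (enorm (f 0)), 0.
Qed.

Lemma eq_supnorm f g :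
  (forall t, enorm (f t) = enorm (g t)) -> supnorm f = supnorm g.
Proof. by move=> fg; congr sup; apply: eq_imagel => t _; exact: fg. Qed.

Lemma supnorm0 : supnorm (fun=> 0) = 0.
Proof.
rewrite /supnorm [X in sup X](_ : _ = [set 0]) ?sup1//.
apply/seteqP; split=> [_ [t _ <-]|_ ->]; first by rewrite enorm0.
by exists 0 => //; rewrite enorm0.
Qed.

End C1norm.

(* The type of arclength parametrized, injective, closed C^{1,1} curves of
   length L; functions on R/LZ are L-periodic functions on R. The Lipschitz
   condition uses the sup norm of 'rV[R]_3, which only affects the constant. *)
Record C11ia (R : realType) (L : {posnum R}) := MkC11ia {
  curve :> R -> 'rV[R]_3 ;
  curve_periodic : forall t, curve (t + L%:num) = curve t ;
  curve_derivable : forall t, derivable curve t 1 ;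
  curve_lipschitz : [lipschitz derive1 curve t | t in [set: R]] ;
  curve_arclength : forall t, enorm (derive1 curve t) = 1 ;
  curve_injective : {in `[0, L%:num[ &, injective curve}
}.

Section C11ia_metric.
Context {R : realType} {L : {posnum R}}.
Implicit Types g h k : C11ia L.

Lemma curve_inj g h : curve g = curve h -> g = h.
Proof.
case: g => g a b c d e; case: h => h a' b' c' d' e' /= gh; subst h.
by congr MkC11ia; exact: Prop_irrelevance.
Qed.

Lemma curve_periodicz g (m : int) t : g (t + m%:~R * L%:num) = g t.
Proof.
have pn (n : nat) s : g (s + n%:R * L%:num) = g s.
  elim: n s => [|n IH] s; first by rewrite mul0r addr0.
  by rewrite -natr1 mulrDl mul1r addrA curve_periodic.
case: m => n; first exact: pn.
by rewrite NegzE -{2}(subrK (n.+1%:R * L%:num) t) pn mulrNz mulNr.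
Qed.

Lemma enorm_curve_continuous g : continuous (fun t => enorm (g t)).
Proof.
move=> t.
have gc i : {for t, continuous (fun s => g s 0 i)}.
  apply: (@continuous_comp _ _ _ g (fun M : 'rV[R]_3 => M 0 i)).
    by apply/differentiable_continuous/derivable1_diffP/curve_derivable.
  exact: coord_continuous.
apply: (@continuous_comp _ _ _ (fun t => dotv (g t) (g t)) Num.sqrt).
  rewrite /dotv /continuous_at.
  apply: (@cvg_big _ _ _ _ _ _ _ _ _ (fun i s => g s 0 i * g s 0 i)) => [|i _].
    exact: add_continuous.
  by apply: cvgM; exact: gc.
exact: sqrt_continuous.
Qed.

Lemma curve_bounded g : ebounded g.
Proof.
have L0 : 0 < L%:num by [].
have [c _ cmax] := @EVT_max R (fun t => enorm (g t)) 0 L%:num (ltW L0)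
  (continuous_subspaceT (@enorm_curve_continuous g)).
exists (enorm (g c)) => t.
rewrite -(curve_periodicz g (- Num.floor (t / L%:num)) t).
apply: cmax; rewrite in_itv /= mulrNz mulNr subr_ge0 lerBlDr.
rewrite -ler_pdivlMr// floor_le /=.
rewrite -[X in X + _]mul1r -mulrDl -ler_pdivrMr// addrC ltW//.
by have /andP[_] := floor_itv (t / L%:num); rewrite intrD.
Qed.

Lemma diff_bounded g h : ebounded (g \- h).
Proof.
have [[M gM] [N hN]] := (curve_bounded g, curve_bounded h).
exists (M + N) => t; apply: (le_trans (enorm_triangle _ _)).
by rewrite enormN lerD.
Qed.

Lemma derive_diff g h t : derive1 (g \- h) t = derive1 g t - derive1 h t.
Proof.
rewrite !derive1E; apply: deriveB; exact: curve_derivable.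
Qed.

Lemma derive_diff_bounded g h : ebounded (derive1 (g \- h)).
Proof.
exists 2 => t; rewrite derive_diff (le_trans (enorm_triangle _ _))//.
by rewrite enormN !curve_arclength.
Qed.

Definition C1dist g h : R := C1norm (g \- h).

Lemma C1distxx g : C1dist g g = 0.
Proof.
rewrite /C1dist /C1norm.
rewrite (@eq_supnorm _ _ (fun=> 0)) => [|t]; last by rewrite /= subrr.
rewrite (@eq_supnorm _ (derive1 _) (fun=> 0)) => [|t].
  by rewrite supnorm0 addr0.
by rewrite derive_diff subrr.
Qed.

Lemma C1dist_positivity g h : C1dist g h = 0 -> g = h.
Proof.
move=> gh0; apply: curve_inj; apply/funext => t; apply/eqP; rewrite -subr_eq0.
apply/eqP/enorm_eq0/eqP; rewrite eq_le enorm_ge0 andbT.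
have h1 := supnorm_ub t (diff_bounded g h).
have h2 := supnorm_ub t (derive_diff_bounded g h).
rewrite -gh0 (le_trans h1)// lerDl (le_trans _ h2)//.
exact: enorm_ge0.
Qed.

Lemma C1dist_sym g h : C1dist g h = C1dist h g.
Proof.
have E0 t : enorm ((g \- h) t) = enorm ((h \- g) t) by rewrite -enormN opprB.
have E1 t : enorm (derive1 (g \- h) t) = enorm (derive1 (h \- g) t).
  by rewrite (derive_diff g h) (derive_diff h g) -enormN opprB.
exact: (f_equal2 +%R (eq_supnorm E0) (eq_supnorm E1)).
Qed.

Lemma C1dist_triangle h g k : C1dist g k <= C1dist g h + C1dist h k.
Proof.
rewrite /C1dist /C1norm addrACA; apply: lerD; apply: supnorm_le => t.
  have -> : (g \- k) t = (g \- h) t + (h \- k) t by rewrite /= addrA subrK.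
  apply: (le_trans (enorm_triangle _ _)); apply: lerD; apply: supnorm_ub;
    exact: diff_bounded.
have -> : derive1 (g \- k) t = derive1 (g \- h) t + derive1 (h \- k) t.
  by rewrite !derive_diff addrA subrK.
apply: (le_trans (enorm_triangle _ _)); apply: lerD; apply: supnorm_ub;
  exact: derive_diff_bounded.
Qed.

HB.instance Definition _ := gen_eqMixin (C11ia L).
HB.instance Definition _ := gen_choiceMixin (C11ia L).
HB.instance Definition _ := @isMetric.Build R (C11ia L) C1dist
  C1distxx C1dist_positivity C1dist_sym C1dist_triangle.

End C11ia_metric.

Section Ropelength.
Context {R : realType}.
Local Open Scope ereal_scope.

(* A circle through x, y, z has its center in the plane spanned by these points
   and at the same distance r from each of them. For three distinct points there
   is at most one such r, and none if they are collinear: the infimum is then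
   the radius of the circumcircle, resp. +oo. *)
Definition circumradius (x y z : 'rV[R]_3) : \bar R :=
  ereal_inf [set r%:E | r in [set r : R | exists a b : R,
    let c := (x + a *: (y - x) + b *: (z - x))%R in
    [/\ enorm (x - c)%R = r, enorm (y - c)%R = r & enorm (z - c)%R = r]]].

Context {L : {posnum R}}.
Implicit Type g : C11ia L.

Definition thickness g : \bar R :=
  ereal_inf [set rho | exists s t u : R,
    [/\ s \in `[0%R, L%:num[, t \in `[0%R, L%:num[, u \in `[0%R, L%:num[,
        [/\ s != t, t != u & u != s] &
        rho = circumradius (g s) (g t) (g u)]].

(* On \bar R the library sets 0^-1 = +oo and +oo^-1 = 0. *)
Definition ropelength g : \bar R := L%:num%:E / thickness g.

End Ropelength.

Section Biarcs.
Context {R : realType}.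
Implicit Types (g : R -> 'rV[R]_3) (a b : R).

Definition is_segment g a b : Prop :=
  exists p w : 'rV[R]_3, enorm w = 1 /\
    forall t, t \in `[a, b] -> g t = p + (t - a) *: w.

Definition is_circular_arc g a b : Prop :=
  exists (c u v : 'rV[R]_3) (r : R), [/\ 0 < r, orthonormal_pair u v &
    forall t, t \in `[a, b] -> g t =
      c + (r * cos ((t - a) / r)) *: u + (r * sin ((t - a) / r)) *: v].

Definition is_arc g a b : Prop := is_circular_arc g a b \/ is_segment g a b.

(* The arclength parametrized curve g, restricted to [a, b], is a biarc
   interpolating ([g a, g' a], [g b, g' b]). Tangent continuity at the point m
   where the two arcs meet is not repeated, as g will always be C^1. *)
Definition is_biarc g a b : Prop :=
  g a <> g b /\ exists m, [/\ a < m, m < b, is_arc g a m & is_arc g m b].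

Context {L : {posnum R}}.
Implicit Types (gamma : C11ia L) (s : nat -> R) (n : nat).

(* The parameters s 0 < ... < s n = s 0 + L of the junctions exhibit gamma as a
   closed biarc curve in the class B_n. As gamma is parametrized by arclength,
   the i-th biarc has length lambda_i = s (i + 1) - s i, and gamma itself has
   length L. The values of s beyond n are irrelevant. *)
Definition biarc_decomposition n gamma s : Prop :=
  [/\ s n = s 0%N + L%:num,
      forall i, (i < n)%N -> s i < s i.+1,
      forall i, (i < n)%N -> is_biarc gamma (s i) (s i.+1) &
      forall i, (i < n)%N ->
        L%:num / (2 * n%:R) <= s i.+1 - s i <= 2 * L%:num / n%:R].

Definition biarc_class n : set (C11ia L) :=
  [set gamma | exists s, biarc_decomposition n gamma s].

Definition tp_sum n (q : R) gamma s : R :=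
  \sum_(i < n) \sum_(j < n | j != i)
    (2 * dist_line (gamma (s j)) (derive1 gamma (s j)) (gamma (s i))
       / enorm (gamma (s i) - gamma (s j)) ^+ 2) `^ q
    * (s i.+1 - s i) * (s j.+1 - s j).

(* A curve may be decomposed into n biarcs in several ways; the energy of the
   curve is the infimum of the energies of its decompositions. It is +oo when
   gamma is not in B_n (lemma tp_energy_notin). *)
Definition tp_energy n (q : R) gamma : \bar R :=
  ereal_inf [set (tp_sum n q gamma s)%:E | s in biarc_decomposition n gamma].

Lemma tp_energy_notin n (q : R) gamma :
  ~ biarc_class n gamma -> tp_energy n q gamma = +oo%E.
Proof.
move=> gB; rewrite /tp_energy (_ : [set _ | _ in _] = set0) ?ereal_inf0//.
by rewrite -subset0 => r [s gs _]; case: gB; exists s.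
Qed.

Lemma tp_energy_le n (q : R) gamma s : biarc_decomposition n gamma s ->
  (tp_energy n q gamma <= (tp_sum n q gamma s)%:E)%E.
Proof. by move=> gs; apply: ereal_inf_lbound; exists s. Qed.

End Biarcs.

Section Gamma_convergence.
Context {R : realType} {X : metricType R}.
Local Open Scope ereal_scope.

Definition Gamma_converges (F_ : nat -> X -> \bar R) (F : X -> \bar R) : Prop :=
  (forall (x_ : nat -> X) (x : X), x_ @ \oo --> x ->
     F x <= limn_einf (fun n => F_ n (x_ n))) /\
  (forall x : X, exists2 x_ : nat -> X, x_ @ \oo --> x &
     limn_esup (fun n => F_ n (x_ n)) <= F x).

End Gamma_convergence.

(* Main.v *)
Require Import Defs.
From mathcomp Require Import all_boot all_order all_algebra.
From mathcomp Require Import all_classical all_reals all_analysis.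
From mathcomp Require Import ring lra.

Set Implicit Arguments.
Unset Strict Implicit.
Unset Printing Implicit Defensive.

Import Order.TTheory GRing.Theory Num.Theory.
Import numFieldNormedType.Exports.

Local Open Scope classical_set_scope.
Local Open Scope ring_scope.

(* The bridge between the two functionals is the bound [tp_le x K]: for all s, t
   the tangent-point quotient 2 dist(l(t), x(s)) / |x(s) - x(t)|^2 is at most K.
   It is equivalent to thickness x >= 1/K, i.e. to R(x) <= L K.

   Liminf: if R(x) > L K, some pair (s, t) violates the bound with K' > K. The
   violation is open in C^1, so every C^1-close biarc curve with short biarcs has
   a pair of junctions violating it, and that single summand gives
   (E_n^n)^(1/n) >= K' (L / 2n)^(2/n), eventually at least K L^(2/n).

   Limsup: x is interpolated by balanced biarcs at n equidistant points with the
   tangents of x, and rescaled by s -> 1 to length L. The energy only sees the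
   junctions, where the quotients are at most K/s, so E_n^n <= (K/s)^n L^2. *)

(** [tp_le x K] says that every circle tangent to the curve at one point and passing through another
    has radius at least 1/K. Such circles are limits of circles through three points of the curve,
    so a thickness bound gives [tp_le]. The converse is global and rests on one observation: under
    [tp_le], a critical point of the distance to a centre c that lies closer than 1/K to c is the
    strict global minimum ([critical_strict_min]). With c on the curve itself, the same observation
    separates parameters that are far apart, and this makes injectivity stable under C^1-small
    perturbations. That stability is what the limsup part hinges on: a recovery curve must be
    injective, of unit speed and of length exactly L, whereas the interpolating biarcs have a total
    length that is only close to L. A dilation repairs the length, keeps the tangents and the arcs,
    and changes the tangent-point quotients by the factor 1/s only. *)

Section Vectors.
Context {R : realType}.
Implicit Types (u v w p q : 'rV[R]_3) (a b M : R).

Lemma dotvC u v : dotv u v = dotv v u.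
Proof. by rewrite !dotvE; ring. Qed.

Lemma dotvDl u v w : dotv (u + v) w = dotv u w + dotv v w.
Proof. by rewrite !dotvE !mxE; ring. Qed.

Lemma dotvDr u v w : dotv w (u + v) = dotv w u + dotv w v.
Proof. by rewrite !dotvE !mxE; ring. Qed.

Lemma dotvNl u w : dotv (- u) w = - dotv u w.
Proof. by rewrite !dotvE !mxE; ring. Qed.

Lemma dotvNr u w : dotv w (- u) = - dotv w u.
Proof. by rewrite !dotvE !mxE; ring. Qed.

Lemma dotvZl a u w : dotv (a *: u) w = a * dotv u w.
Proof. by rewrite !dotvE !mxE; ring. Qed.

Lemma dotvZr a u w : dotv w (a *: u) = a * dotv w u.
Proof. by rewrite !dotvE !mxE; ring. Qed.

Definition dotv_lin := (dotvDl, dotvDr, dotvNl, dotvNr, dotvZl, dotvZr).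

Lemma dotv0l u : dotv 0 u = 0.
Proof. by rewrite -(scale0r 0) dotvZl mul0r. Qed.

Lemma enorm_sqr u : enorm u ^+ 2 = dotv u u.
Proof. by rewrite /enorm sqr_sqrtr ?dotv_ge0. Qed.

Lemma enorm1_dotv u : enorm u = 1 -> dotv u u = 1.
Proof. by move=> u1; rewrite -enorm_sqr u1 expr1n. Qed.

Lemma enormZ a u : enorm (a *: u) = `|a| * enorm u.
Proof.
rewrite /enorm dotvZl dotvZr mulrA -expr2 sqrtrM ?sqr_ge0//.
by rewrite sqrtr_sqr.
Qed.

Lemma enorm_le_sqr u M : 0 <= M -> dotv u u <= M ^+ 2 -> enorm u <= M.
Proof.
move=> M0; rewrite -enorm_sqr ler_pXn2r ?nnegrE ?enorm_ge0//.
Qed.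

Lemma enorm_eqP u M : 0 <= M -> dotv u u = M ^+ 2 -> enorm u = M.
Proof. by move=> M0 uM; rewrite /enorm uM sqrtr_sqr ger0_norm. Qed.

Lemma enormB u v : enorm (u - v) = enorm (v - u).
Proof. by rewrite -enormN opprB. Qed.

Lemma enorm_triangleB w u v : enorm (u - v) <= enorm (u - w) + enorm (w - v).
Proof. by rewrite -(subrKA w) enorm_triangle. Qed.

Lemma enorm_lerB u v : enorm u - enorm v <= enorm (u - v).
Proof. by rewrite lerBlDr -{1}(subrK v u) enorm_triangle. Qed.

Lemma normr_dotv_le u v : `|dotv u v| <= enorm u * enorm v.
Proof.
by rewrite ler_norml dotv_le andbT lerNl -dotvNl -(enormN u) dotv_le.
Qed.

Lemma enorm_gt0 u : u != 0 -> 0 < enorm u.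
Proof.
move=> u0; rewrite lt_neqAle enorm_ge0 andbT eq_sym.
by apply: contra u0 => /eqP/enorm_eq0 ->.
Qed.

Lemma normr_coord_le u i : `|u 0 i| <= enorm u.
Proof.
rewrite -sqrtr_sqr ler_sqrt ?dotv_ge0// /dotv (bigD1 i)//= -expr2.
by rewrite lerDl sumr_ge0// => j _; rewrite -expr2 sqr_ge0.
Qed.

Lemma mx_norm_le_enorm u : `|u| <= enorm u.
Proof.
rewrite [leLHS]/Num.Def.normr/= mx_normrE.
apply: bigmax_le; first exact: enorm_ge0.
by move=> [i j] _ /=; rewrite (ord1 i) normr_coord_le.
Qed.

Lemma enorm_le_mx_norm u : enorm u <= 2 * `|u|.
Proof.
have ui i : u 0 i * u 0 i <= `|u| ^+ 2.
  rewrite -expr2 -real_normK ?num_real// ler_pXn2r ?nnegrE//.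
  rewrite [leRHS]/Num.Def.normr/= mx_normrE.
  exact: (le_bigmax _ (fun ij : 'I_1 * 'I_3 => `|u ij.1 ij.2|) (0, i)).
apply: enorm_le_sqr; first by rewrite mulr_ge0.
rewrite dotvE; have := ui 0; have := ui 1; have := ui (2%:R); nra.
Qed.

(** Completing the square in [tau]: the infimum is attained at [tau = dotv (q - p) w]. *)
Lemma dist_lineE p w q : enorm w = 1 ->
  dist_line p w q =
  Num.sqrt (dotv (q - p) (q - p) - dotv (q - p) w ^+ 2).
Proof.
move=> w1; have ww := enorm1_dotv w1.
have E tau : dotv (q - (p + tau *: w)) (q - (p + tau *: w)) =
    dotv (q - p) (q - p) - dotv (q - p) w ^+ 2 + (tau - dotv (q - p) w) ^+ 2.
  rewrite opprD addrA; move: (q - p) => P.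
  by rewrite !dotv_lin ww (dotvC w P); ring.
apply/eqP; rewrite eq_le; apply/andP; split.
- apply: ge_inf; first by exists 0 => _ [tau _ <-]; exact: enorm_ge0.
  by exists (dotv (q - p) w) => //; rewrite /enorm E subrr expr0n addr0.
- apply: lb_le_inf; first by exists (enorm (q - (p + 0 *: w))), 0.
  by move=> _ [tau _ <-]; rewrite /enorm E ler_wsqrtr// lerDl sqr_ge0.
Qed.

Lemma dist_line_sqr p w q : enorm w = 1 ->
  dist_line p w q ^+ 2 = dotv (q - p) (q - p) - dotv (q - p) w ^+ 2.
Proof.
move=> w1; rewrite dist_lineE// sqr_sqrtr// subr_ge0 -real_normK ?num_real//.
rewrite -enorm_sqr ler_pXn2r ?nnegrE ?enorm_ge0//.
by apply: (le_trans (normr_dotv_le _ _)); rewrite w1 mulr1.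
Qed.

Lemma dist_line_ge0 p w q : enorm w = 1 -> 0 <= dist_line p w q.
Proof. by move=> /dist_lineE ->; exact: sqrtr_ge0. Qed.

(** Sliding [p] along the line does not change the product with a normal vector, so Cauchy-Schwarz
    can be applied from every point of the line before taking the infimum. *)
Lemma dotv_normal_le p w q n : enorm w = 1 -> dotv n w = 0 ->
  dotv (q - p) n <= dist_line p w q * enorm n.
Proof.
move=> w1 nw; have [->|n0] := eqVneq n 0.
  by rewrite dotvC dotv0l enorm0 mulr0.
rewrite -ler_pdivrMr ?enorm_gt0//; apply: lb_le_inf.
  by exists (enorm (q - (p + 0 *: w))), 0.
move=> _ [tau _ <-]; rewrite ler_pdivrMr ?enorm_gt0//.
rewrite (_ : dotv _ n = dotv (q - (p + tau *: w)) n) ?dotv_le//.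
rewrite opprD addrA; move: (q - p) => P.
by rewrite !dotv_lin (dotvC w) nw mulr0 subr0.
Qed.

End Vectors.

(** * Calculus of vector-valued functions *)

Section Derivatives.
Context {R : realType}.
Implicit Types (f g : R -> 'rV[R]_3) (t : R).

Lemma is_derive_rowP f t (df : 'rV[R]_3) :
  is_derive t 1 f df <-> forall i, is_derive t 1 (fun s => f s 0 i) (df 0 i).
Proof.
split=> [[fd <-] i|fi].
  have fdi := (derivable_mxP _ _ _).1 fd 0 i.
  by apply: DeriveDef => //; rewrite derive_mx// mxE.
have fd : derivable f t 1.
  by apply/derivable_mxP => i j; rewrite (ord1 i); case: (fi j).
apply: DeriveDef => //; rewrite derive_mx//; apply/rowP => i.
by rewrite mxE; case: (fi i).
Qed.

Lemma is_derive_dotv f g t (df dg : 'rV[R]_3) :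
  is_derive t 1 f df -> is_derive t 1 g dg ->
  is_derive t 1 (fun s => dotv (f s) (g s)) (dotv df (g t) + dotv (f t) dg).
Proof.
move=> /is_derive_rowP fd /is_derive_rowP gd.
have fd0 := fd 0; have fd1 := fd 1; have fd2 := fd 2%:R.
have gd0 := gd 0; have gd1 := gd 1; have gd2 := gd 2%:R.
have -> : (fun s => dotv (f s) (g s)) =
    (fun s => f s 0 0) * (fun s => g s 0 0) + (fun s => f s 0 1) * (fun s => g s 0 1)
    + (fun s => f s 0 2%:R) * (fun s => g s 0 2%:R).
  by apply/funext => s; rewrite dotvE.
have := is_deriveD (is_deriveD (is_deriveM fd0 gd0) (is_deriveM fd1 gd1))
  (is_deriveM fd2 gd2).
move=> /is_derive_eq; apply; rewrite !dotvE /GRing.scale.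
move: (f t 0 0) (f t 0 1) (f t 0 _) (g t 0 0) (g t 0 1) (g t 0 _) => a b c x y z.
by rewrite /=; ring.
Qed.

Lemma is_derive_dotvl f t (df w : 'rV[R]_3) :
  is_derive t 1 f df -> is_derive t 1 (fun s => dotv (f s) w) (dotv df w).
Proof.
move=> fd; have wd : is_derive t 1 (fun=> w) (0 : 'rV[R]_3) by exact: is_derive_cst.
have := is_derive_dotv fd wd.
by rewrite (dotvC _ 0) dotv0l addr0.
Qed.

(** Pairing with the chord [w = f b - f a] reduces the claim to the scalar mean value theorem;
    cancelling one factor |w| gives the length of the chord. *)
Lemma enorm_increment_le f (df : R -> 'rV[R]_3) (M a b : R) : a <= b ->
  (forall t, t \in `[a, b] -> is_derive t 1 f (df t)) ->
  (forall t, t \in `[a, b] -> enorm (df t) <= M) ->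
  enorm (f b - f a) <= M * (b - a).
Proof.
move=> ab fd dfM; set w := f b - f a.
have [c cab fc] : exists2 c, c \in `[a, b]%R &
    dotv (f b) w - dotv (f a) w = dotv (df c) w * (b - a).
  have Fd x : x \in `[a, b]%R -> is_derive x 1 (fun t => dotv (f t) w) (dotv (df x) w).
    by move=> xab; apply: is_derive_dotvl; exact: fd.
  have Fc : {within `[a, b], continuous (fun t => dotv (f t) w)}.
    by apply: derivable_within_continuous => x /Fd[].
  have Fd' x : x \in `]a, b[%R -> is_derive x 1 (fun t => dotv (f t) w) (dotv (df x) w).
    by move=> xab; apply: Fd; exact: subset_itv_oo_cc.
  exact: (MVT_segment ab Fd' Fc).
have [->|w0] := eqVneq w 0.
  by rewrite enorm0 mulr_ge0 ?subr_ge0// (le_trans (enorm_ge0 _) (dfM c cab)).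
have w_gt0 := enorm_gt0 w0.
rewrite -(ler_pM2r w_gt0) -expr2 enorm_sqr {1}/w dotvDl dotvNl fc.
rewrite mulrAC ler_wpM2r ?subr_ge0//.
by rewrite (le_trans (dotv_le _ _))// ler_wpM2r ?enorm_ge0 ?dfM.
Qed.

Lemma cvg_dotv {T : Type} {F : set_system T} {FF : Filter F}
    (f g : T -> 'rV[R]_3) (u v : 'rV[R]_3) :
  f @ F --> u -> g @ F --> v -> (fun x => dotv (f x) (g x)) @ F --> dotv u v.
Proof.
move=> fu gv; rewrite /dotv.
have coord (h : T -> 'rV[R]_3) (w : 'rV[R]_3) i :
    h @ F --> w -> (fun x => h x 0 i : R) @ F --> (w 0 i : R).
  move=> hw; apply: (@cvg_comp _ _ _ h (fun M : 'rV[R]_3 => M 0 i) F _ _ hw).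
  exact: coord_continuous.
apply: (@cvg_big _ _ _ _ _ _ _ _ _ (fun i x => f x 0 i * g x 0 i)) => [|i _].
  exact: add_continuous.
by apply: cvgM; exact: coord.
Qed.

End Derivatives.

(** * Unit-speed curves with Lipschitz tangent *)

Section ArclengthCurves.
Context {R : realType}.
Implicit Types (f df : R -> 'rV[R]_3) (C M a b s t : R) (w : 'rV[R]_3).

(** Unlike [C11ia], this asks for neither periodicity nor injectivity, and it carries the derivative
    and a Euclidean Lipschitz constant explicitly, so that single arcs can be glued and rescaled
    with control of [C]. *)
Definition arclength_curve C f df : Prop :=
  [/\ forall t, is_derive t 1 f (df t), forall t, enorm (df t) = 1 &
      forall s t, enorm (df s - df t) <= C * `|s - t|].

Lemma enorm_increment_affine f df M a b w : a <= b ->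
  (forall t, t \in `[a, b] -> is_derive t 1 f (df t)) ->
  (forall t, t \in `[a, b] -> enorm (df t - w) <= M) ->
  enorm (f b - f a - (b - a) *: w) <= M * (b - a).
Proof.
move=> ab fd dfw.
have -> : f b - f a - (b - a) *: w = (f b - b *: w) - (f a - a *: w).
  by apply/rowP => i; rewrite !mxE; ring.
apply: (@enorm_increment_le _ (fun t => f t - t *: w) (fun t => df t - w)) => //.
move=> t /fd fdt; apply/is_derive_rowP => i.
have fdi := (is_derive_rowP _ _ _).1 fdt i.
have idi := is_deriveM (is_derive_id t 1) (is_derive_cst (w 0 i : R) t 1).
have -> : (fun s => (f s - s *: w) 0 i) =
    (fun s => f s 0 i) - (id * cst (w 0 i)).
  by apply/funext => s; rewrite !mxE.
apply: is_derive_eq (is_deriveB fdi idi) _.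
by rewrite !mxE scaler0 add0r /GRing.scale /= mulr1.
Qed.

Lemma arclength_taylor C f df t u : arclength_curve C f df -> 0 <= C ->
  enorm (f u - f t - (u - t) *: df t) <= C * `|u - t| ^+ 2.
Proof.
move=> [fd _ dfC] C0.
have [tu|/ltW ut] := leP t u.
  rewrite ger0_norm ?subr_ge0// expr2 mulrA.
  apply: (@enorm_increment_affine _ df) => // v /[!in_itv]/= /andP[tv vu].
  rewrite (le_trans (dfC _ _))// ler_wpM2l// ger0_norm ?subr_ge0// lerD2r//.
rewrite distrC ger0_norm ?subr_ge0// expr2 mulrA -enormN.
have -> : - (f u - f t - (u - t) *: df t) = f t - f u - (t - u) *: df t.
  by apply/rowP => i; rewrite !mxE; ring.
apply: (@enorm_increment_affine _ df) => // v /[!in_itv]/= /andP[uv vt].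
rewrite (le_trans (dfC _ _))// ler_wpM2l// distrC ger0_norm ?subr_ge0//.
by rewrite lerD2l lerN2.
Qed.

Lemma arclength_increment_le C f df a b : arclength_curve C f df ->
  enorm (f b - f a) <= `|b - a|.
Proof.
move=> [fd df1 _]; wlog ab : a b / a <= b => [H|].
  have [/H//|/ltW/H] := leP a b.
  by rewrite enormB distrC.
rewrite ger0_norm ?subr_ge0// -[leRHS]mul1r.
by apply: (@enorm_increment_le _ _ df) => // t _; rewrite df1.
Qed.

End ArclengthCurves.

(** * The tangent-point bound and critical points of the distance to a centre *)

Section Curves.
Context {R : realType} {L : {posnum R}}.
Implicit Types (x : C11ia L) (s t u K : R).

Lemma curve_is_derive x t : is_derive t 1 x (derive1 x t).
Proof. by rewrite derive1E; apply: derivableP; exact: curve_derivable. Qed.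

Lemma curve_arclength_curve x : exists2 C, 0 <= C & arclength_curve C x (derive1 x).
Proof.
have := curve_lipschitz x.
rewrite /lipschitz_on => /pinfty_ex_gt0[M M0 xM].
(* The factor 2 pays for passing from the sup norm to the Euclidean norm in dimension 3. *)
exists (2 * M); first by rewrite mulr_ge0 ?ltW.
split; [exact: curve_is_derive|exact: curve_arclength|move=> s t].
rewrite (le_trans (enorm_le_mx_norm _))// -mulrA ler_wpM2l//.
exact: (xM (s, t)).
Qed.

Lemma derive1_periodicz x (m : int) t :
  derive1 x (t + m%:~R * L%:num) = derive1 x t.
Proof.
rewrite !derive1E /derive.
suff -> : (fun h : R => h^-1 *: ((x \o shift (t + m%:~R * L%:num)) (h *: 1%R)
    - x (t + m%:~R * L%:num))) =
  (fun h : R => h^-1 *: ((x \o shift t) (h *: 1%R) - x t)) by [].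
by apply/funext => h /=; rewrite addrA !curve_periodicz.
Qed.

Lemma period_reduce t : exists m : int,
  0 <= t + m%:~R * L%:num < L%:num.
Proof.
exists (- Num.floor (t / L%:num)).
have L0 : 0 < L%:num by [].
have /andP[f1 f2] := floor_itv (t / L%:num).
rewrite mulrNz mulNr subr_ge0 ltrBlDr -ler_pdivlMr// f1 /=.
by rewrite -[X in X + _]mul1r -mulrDl -ltr_pdivrMr// addrC -[1 in X in _ < X]/(1%:~R) -intrD.
Qed.

Lemma curve_neq x s t : 0 < `|s - t| < L%:num -> x s <> x t.
Proof.
wlog ts : s t / t < s => [H|].
  case: (ltgtP t s) => [/H//|st|->]; last by rewrite subrr normr0 ltxx.
  by rewrite distrC => /(H _ _ st) xts /esym.
rewrite gtr0_norm ?subr_gt0// => /andP[_ stL] xst.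
have [m /andP[t0 tL]] := period_reduce t.
have L0 : 0 < L%:num by [].
pose t' := t + m%:~R * L%:num; pose s' := s + m%:~R * L%:num.
have xst' : x s' = x t' by rewrite !curve_periodicz.
have ts' : t' < s' by rewrite ltrD2r.
have [s'L|Ls'] := ltP s' L%:num.
  have : s' = t'.
    by apply: (@curve_injective _ _ x) => //; rewrite in_itv /=; apply/andP; split;
      rewrite ?(le_trans t0 (ltW ts')).
  by move=> s't'; move: ts'; rewrite s't' ltxx.
have : s' - L%:num = t'.
  apply: (@curve_injective _ _ x) => //; last 1 first.
  - by rewrite -xst' -[in RHS](subrK L%:num s') curve_periodic.
  - rewrite in_itv /= subr_ge0 Ls' /= ltrBlDr.
    by rewrite /s'; rewrite /t' in tL; lra.
  - by rewrite in_itv /= t0 tL.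
by rewrite /s' /t' => e; lra.
Qed.

(** Multiplied out, so that pairs with [x s = x t] are harmless: both sides then vanish. *)
Definition tp_le x K := forall s t,
  2 * dist_line (x t) (derive1 x t) (x s) <= K * enorm (x s - x t) ^+ 2.

Lemma is_derive_dist_sqr x (c : 'rV[R]_3) t :
  is_derive t 1 (fun s => dotv (x s - c) (x s - c))
    (2 * dotv (x t - c) (derive1 x t)).
Proof.
have xd : is_derive t 1 (fun s => x s - c) (derive1 x t).
  have := is_deriveB (curve_is_derive x t) (is_derive_cst c t 1).
  by rewrite subr0.
apply: is_derive_eq (is_derive_dotv xd xd) _.
by rewrite dotvC mulr2n mulrDl mul1r.
Qed.

(** With P = x s - x t and the normal vector N = c - x t, one has |P - N|^2 - |N|^2 = |P|^2 - 2 P.N,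
    and 2 P.N <= 2 dist |N| <= K |P|^2 |N| < |P|^2. *)
Lemma critical_strict_min x K (c : 'rV[R]_3) s t : 0 < K -> tp_le x K ->
  dotv (x t - c) (derive1 x t) = 0 -> K * enorm (x t - c) < 1 -> x s <> x t ->
  enorm (x t - c) < enorm (x s - c).
Proof.
move=> K0 xK tc Kr st.
rewrite -(@ltr_pXn2r _ 2)// ?nnegrE ?enorm_ge0// !enorm_sqr.
set P := x s - x t; set N := c - x t.
have P0 : 0 < dotv P P.
  by rewrite -enorm_sqr exprn_gt0// enorm_gt0// subr_eq0; apply/eqP.
have -> : x t - c = - N by rewrite opprB.
have -> : x s - c = P - N by apply/rowP => i; rewrite !mxE; ring.
have N0 : dotv N (derive1 x t) = 0 by rewrite /N -opprB dotvNl tc oppr0.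
have rE : enorm (x t - c) = enorm N by rewrite enormB.
have h1 := dotv_normal_le (x t) (x s) (curve_arclength x t) N0.
have h2 := xK s t; rewrite enorm_sqr -/P in h2.
rewrite rE in Kr; have N_ge0 := enorm_ge0 N.
rewrite -/P in h1; clearbody P N; rewrite !dotv_lin !opprK (dotvC N P).
have h3 : 2 * dotv P N <= K * dotv P P * enorm N.
  rewrite (le_trans _ (ler_wpM2r N_ge0 h2))// -mulrA ler_pM2l//.
have h4 : K * dotv P P * enorm N < dotv P P.
  by rewrite mulrAC -[ltRHS]mul1r ltr_pM2r.
lra.
Qed.

(** A minimum of the distance over [[a, b]] with value below [r] cannot sit at an endpoint, so it is
    interior and therefore critical. *)
Lemma dip_or_above x (c : 'rV[R]_3) (r a b : R) : a <= b ->
  enorm (x a - c) = r -> enorm (x b - c) = r ->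
  (forall t, t \in `[a, b] -> r <= enorm (x t - c)) \/
  (exists m, [/\ m \in `]a, b[, enorm (x m - c) < r &
                 dotv (x m - c) (derive1 x m) = 0]).
Proof.
move=> ab xa xb; pose f t := dotv (x t - c) (x t - c).
have fd t : is_derive t 1 f (2 * dotv (x t - c) (derive1 x t)).
  exact: is_derive_dist_sqr.
have fc : {within `[a, b], continuous f}.
  by apply: derivable_within_continuous => t _; case: (fd t).
have [m mab mmin] := EVT_min ab fc.
have [rm|mr] := leP r (enorm (x m - c)).
  left=> t /mmin; rewrite /f -!enorm_sqr ler_pXn2r ?nnegrE ?enorm_ge0//.
  exact: le_trans.
right; exists m; have mab' : m \in `]a, b[%R.
  move: mab; rewrite !in_itv /= => /andP[am mb].
  rewrite !lt_neqAle am mb !andbT; apply/andP; split; apply/eqP => e.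
    by move: mr; rewrite -e xa ltxx.
  by move: mr; rewrite e xb ltxx.
split=> //; have f0 : is_derive m 1 f 0.
  apply: (derive1_at_min ab _ mab') => t tab; last first.
    by apply: mmin; exact: subset_itv_oo_cc.
  by have [] := fd t.
have := @derive_val _ _ _ _ _ _ _ f0.
rewrite (@derive_val _ _ _ _ _ _ _ (fd m)) => /eqP.
by rewrite mulf_eq0 pnatr_eq0 /= => /eqP.
Qed.

End Curves.

(** * Equivalence of the tangent-point bound with a thickness bound *)

Section Thickness.
Context {R : realType} {L : {posnum R}}.
Implicit Types (x : C11ia L) (s t u K r : R) (c : 'rV[R]_3).

(** Each of the two points would be the strict global minimum of the distance, hence strictly closer
    to [c] than the other. *)
Lemma two_dips x K c r m m' : 0 < K -> tp_le x K -> K * r < 1 ->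
  0 < `|m - m'| < L%:num ->
  enorm (x m - c) < r -> dotv (x m - c) (derive1 x m) = 0 ->
  enorm (x m' - c) < r -> dotv (x m' - c) (derive1 x m') = 0 -> False.
Proof.
move=> K0 xK Kr mm xm dm xm' dm'.
have xmm := curve_neq (x := x) mm.
have Kle (v : R) : v < r -> K * v < 1.
  by move=> vr; rewrite (lt_trans _ Kr)// ltr_pM2l.
have h1 := critical_strict_min K0 xK dm' (Kle _ xm') xmm.
have h2 := critical_strict_min K0 xK dm (Kle _ xm) (nesym xmm).
by have := lt_trans h1 h2; rewrite ltxx.
Qed.

(** The joint [e] is a local minimum of the distance to [c], hence critical. By
    [critical_strict_min] it is strictly closer to [c] than [x a], although both are at distance
    [r]. *)
Lemma two_above x K c r a e b : 0 < K -> tp_le x K -> K * r < 1 ->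
  a < e -> e < b -> e - a < L%:num ->
  enorm (x a - c) = r -> enorm (x e - c) = r ->
  (forall t, t \in `[a, e] -> r <= enorm (x t - c)) ->
  (forall t, t \in `[e, b] -> r <= enorm (x t - c)) -> False.
Proof.
move=> K0 xK Kr ae eb eaL xa xe ra rb.
pose f t := dotv (x t - c) (x t - c).
have fd t : is_derive t 1 f (2 * dotv (x t - c) (derive1 x t)).
  exact: is_derive_dist_sqr.
have ab := ltW (lt_trans ae eb).
have eab : e \in `]a, b[%R by rewrite in_itv /= ae eb.
have f0 : is_derive e 1 f 0.
  apply: (derive1_at_min ab _ eab) => t; first by have [] := fd t.
  rewrite in_itv /= => /andP[at_ tb].
  rewrite /f -!enorm_sqr ler_pXn2r ?nnegrE ?enorm_ge0// xe.
  have [te|/ltW et] := leP t e; first by apply: ra; rewrite in_itv /= ltW.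
  by apply: rb; rewrite in_itv /= et ltW.
have de : dotv (x e - c) (derive1 x e) = 0.
  have := @derive_val _ _ _ _ _ _ _ f0.
  rewrite (@derive_val _ _ _ _ _ _ _ (fd e)) => /eqP.
  by rewrite mulf_eq0 pnatr_eq0 /= => /eqP.
have xae : x a <> x e.
  by apply: curve_neq; rewrite distrC gtr0_norm ?subr_gt0// ae.
have := critical_strict_min K0 xK de _ xae.
by rewrite xe xa ltxx => /(_ Kr).
Qed.

(* The three points cut the closed curve into three arcs. A ball of radius
   r < 1/K around c can contain a piece of at most one of them, since a critical
   point of the distance to c inside it is the unique global minimum; hence two
   adjacent arcs stay outside, and their common endpoint is critical as well. *)
Lemma circle_radius_ge x K c r s t u : 0 < K -> tp_le x K ->
  s < t -> t < u -> u < s + L%:num ->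
  enorm (x s - c) = r -> enorm (x t - c) = r -> enorm (x u - c) = r ->
  K^-1 <= r.
Proof.
move=> K0 xK st tu usL xs xt xu; rewrite leNgt; apply/negP => rK.
have Kr : K * r < 1 by rewrite mulrC -ltr_pdivlMr// div1r.
have L0 : 0 < L%:num by [].
have xsL : enorm (x (s + L%:num) - c) = r by rewrite curve_periodic.
have dips m m' : m' < m -> m < m' + L%:num ->
    enorm (x m - c) < r -> dotv (x m - c) (derive1 x m) = 0 ->
    enorm (x m' - c) < r -> dotv (x m' - c) (derive1 x m') = 0 -> False.
  move=> mm' mL; apply: (two_dips K0 xK Kr).
  by rewrite gtr0_norm ?subr_gt0// mm' ltrBlDl.
have itvE (m a b : R) : m \in `]a, b[ -> a < m /\ m < b.
  by rewrite in_itv /= => /andP[].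
have [A1|[m1 [/itvE[i1 j1] q1 d1]]] := dip_or_above (ltW st) xs xt;
have [A2|[m2 [/itvE[i2 j2] q2 d2]]] := dip_or_above (ltW tu) xt xu;
have [A3|[m3 [/itvE[i3 j3] q3 d3]]] := dip_or_above (ltW usL) xu xsL.
- by apply: (two_above K0 xK Kr st tu _ xs xt A1 A2); clear -usL tu; lra.
- by apply: (two_above K0 xK Kr st tu _ xs xt A1 A2); clear -usL tu; lra.
(* Here the first and the third arc stay outside. They are adjacent across [s + L], so the first one
   is shifted by a period. *)
- have tL : s + L%:num < t + L%:num by rewrite ltrD2r.
  apply: (two_above K0 xK Kr usL tL _ xu xsL A3); first by clear -st tu; lra.
  move=> v vst; rewrite -(subrK L%:num v) curve_periodic; apply: A1.
  by move: vst; rewrite !in_itv /= lerBrDr lerBlDr.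
- by apply: (dips _ _ _ _ q3 d3 q2 d2); clear -i2 i3 j2 j3 st; lra.
- by apply: (two_above K0 xK Kr tu usL _ xt xu A2 A3); clear -usL st; lra.
- by apply: (dips _ _ _ _ q3 d3 q1 d1); clear -i1 i3 j1 j3 tu; lra.
- by apply: (dips _ _ _ _ q2 d2 q1 d1); clear -i1 i2 j1 j2 usL; lra.
- by apply: (dips _ _ _ _ q2 d2 q1 d1); clear -i1 i2 j1 j2 usL; lra.
Qed.

Lemma tp_le_thickness x K : 0 < K -> tp_le x K ->
  ((K^-1)%:E <= thickness x)%E.
Proof.
move=> K0 xK; apply: le_ereal_inf_tmp => _ [s [t [u [sL tL uL [st tu us] ->]]]].
apply: le_ereal_inf_tmp => _ [r [a [b /= [xs xt xu]]] <-]; rewrite lee_fin.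
move: (x s + _ + _) xs xt xu => c.
move: sL tL uL; rewrite !in_itv /= => /andP[s0 sL] /andP[t0 tL] /andP[u0 uL].
move=> xs xt xu.
have ge v w z : v < w -> w < z -> 0 <= v -> z < L%:num ->
    enorm (x v - c) = r -> enorm (x w - c) = r -> enorm (x z - c) = r ->
    K^-1 <= r.
  by move=> *; apply: (@circle_radius_ge x K c r v w z) => //; lra.
case: (ltgtP s t) st => // st _; case: (ltgtP t u) tu => // tu _;
case: (ltgtP u s) us => // us _; try by clear -st tu us; lra.
- exact: (ge s t u).
- exact: (ge u s t).
- exact: (ge s u t).
- exact: (ge t u s).
- exact: (ge t s u).
- exact: (ge u t s).
Qed.

(** [D] is |P x Q|^2. The coefficients [a], [b] are Cramer's solution of 2 c.P = |P|^2 and 2 c.Q =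
    |Q|^2, which say that the centre y + c is equidistant from the three points. The final identity
    is the square of: radius = product of the sides / (4 area). *)
Lemma circumradius_le (y P Q : 'rV[R]_3) :
  let D := dotv P P * dotv Q Q - dotv P Q ^+ 2 in 0 < D ->
  exists r, [/\ (circumradius y (y + P) (y + Q) <= r%:E)%E, 0 <= r &
    4 * D * r ^+ 2 = dotv P P * dotv Q Q * dotv (P - Q) (P - Q)].
Proof.
move=> D D0.
pose a := dotv Q Q * (dotv P P - dotv P Q) / (2 * D).
pose b := dotv P P * (dotv Q Q - dotv P Q) / (2 * D).
have D0' : D != 0 by rewrite gt_eqF.
pose c := a *: P + b *: Q.
have cP : 2 * dotv c P = dotv P P.
  rewrite /c !dotv_lin (dotvC Q P) /a /b.
  rewrite -[RHS](mulfK D0') [in X in _ = X / _]/D; field.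
  by [].
have cQ : 2 * dotv c Q = dotv Q Q.
  rewrite /c !dotv_lin /a /b.
  rewrite -[RHS](mulfK D0') [in X in _ = X / _]/D; field.
  by [].
have cc : 2 * dotv c c = a * dotv P P + b * dotv Q Q.
  rewrite -cP -cQ {1}/c dotvDl !dotvZl (dotvC P c) (dotvC Q c); ring.
have dc v : 2 * dotv c v = dotv v v -> dotv (v - c) (v - c) = dotv c c.
  by move: (c) => z zv; rewrite !dotv_lin (dotvC v z); lra.
exists (enorm c); split; last 1 first.
- have -> : enorm c ^+ 2 = (a * dotv P P + b * dotv Q Q) / 2.
    by rewrite enorm_sqr -cc mulrC mulKf.
  rewrite !dotv_lin (dotvC Q P) /a /b [in LHS](_ : 4 = 2 * 2) //; last by ring.
  by field.
- apply: ereal_inf_lbound; exists (enorm c) => //; exists a, b => /=.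
  rewrite (_ : y + P - y = P); last by rewrite addrC addKr.
  rewrite (_ : y + Q - y = Q); last by rewrite addrC addKr.
  rewrite -addrA -/c; split.
  + by rewrite -enormN; congr enorm; apply/rowP => i; rewrite !mxE; ring.
  + apply: enorm_eqP; first exact: enorm_ge0.
    rewrite enorm_sqr (_ : y + P - (y + c) = P - c).
      exact: dc.
    by apply/rowP => i; rewrite !mxE; ring.
  + apply: enorm_eqP; first exact: enorm_ge0.
    rewrite enorm_sqr (_ : y + Q - (y + c) = Q - c).
      exact: dc.
    by apply/rowP => i; rewrite !mxE; ring.
- exact: enorm_ge0.
Qed.

(** As h tends to 0, the circles through x t, x (t + h) and x s approach the circle tangent at x t
    and passing through x s. A pair violating the bound thus produces three points of circumradius
    below 1/K. *)
Lemma thickness_tp_le x K : 0 < K -> ((K^-1)%:E <= thickness x)%E -> tp_le x K.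
Proof.
move=> K0 xK.
suff H s t : 0 <= s < L%:num -> 0 <= t < L%:num -> s != t ->
    2 * dist_line (x t) (derive1 x t) (x s) <= K * enorm (x s - x t) ^+ 2.
  move=> s t; have [m sm] := period_reduce (L := L) s.
  have [k tk] := period_reduce (L := L) t.
  rewrite -(curve_periodicz x m s) -(curve_periodicz x k t).
  rewrite -(derive1_periodicz x k t).
  have [->|st] := eqVneq (s + m%:~R * L%:num) (t + k%:~R * L%:num); last exact: H.
  rewrite dist_lineE ?curve_arclength// subrr !dotv0l expr0n subrr sqrtr0.
  by rewrite mulr0 mulr_ge0 ?sqr_ge0// ltW.
move=> sL tL st; rewrite leNgt; apply/negP => Kst.
set P := x s - x t in Kst; set w := derive1 x t in Kst.
pose q h := x (h + t) - x t.
pose q' (h : R) := h^-1 *: q h.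
have q'w : q' h @[h --> 0^'] --> w.
  have := @curve_derivable _ _ x t; rewrite /w derive1E => /cvg_ex[l xl].
  suff <- : l = 'D_1 x t.
    apply: cvg_trans xl; apply: near_eq_cvg.
    by apply: nearW => h; rewrite /q' /q /= /shift /GRing.scale /= mulr1.
  by apply/esym; apply: cvg_lim.
have q0 : q h @[h --> 0^'] --> (0 : 'rV[R]_3).
  have : (fun h : R => h *: q' h) @ 0^' --> (0 : R) *: w.
    by apply: cvgZ => //; exact: nbhs_dnbhs.
  rewrite scale0r; apply: cvg_trans; apply: near_eq_cvg.
  near=> h; rewrite /q' scalerA mulfV ?scale1r//.
  by near: h; exact: nbhs_dnbhs_neq.
(* With Q = q h and D as in [circumradius_le], this is 4 D - K^2 |P|^2 |Q|^2 |P - Q|^2 divided by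
   h^2; without the division the limit would be 0. Positivity means that the circle has radius below
   1/K, and the limit is 4 dist^2 - K^2 |P|^4. *)
pose psi h := 4 * (dotv P P * dotv (q' h) (q' h) - dotv P (q' h) * dotv P (q' h)) -
  K ^+ 2 * (dotv P P * dotv (q' h) (q' h) * dotv (P - q h) (P - q h)).
have psic : psi h @[h --> 0^'] --> 4 * (dotv P P * dotv w w - dotv P w * dotv P w) -
  K ^+ 2 * (dotv P P * dotv w w * dotv (P - 0) (P - 0)).
  have cP : (fun _ : R => P) @ (0 : R)^' --> P by exact: cvg_cst.
  have cPq : (fun h => P - q h) @ 0^' --> P - 0 by apply: cvgB.
  apply: cvgB; apply: cvgMr; last first.
    by apply: cvgM; [apply: cvgMr|]; exact: cvg_dotv.
  apply: cvgB; first by apply: cvgMr; exact: cvg_dotv.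
  have c1 := cvg_dotv cP q'w.
  by apply: cvgM; exact: c1.
have lim_gt0 : 0 < 4 * (dotv P P * dotv w w - dotv P w * dotv P w) -
  K ^+ 2 * (dotv P P * dotv w w * dotv (P - 0) (P - 0)).
  have w1 : enorm w = 1 by exact: curve_arclength.
  rewrite subr0 (enorm1_dotv w1) !mulr1 -expr2 -(dist_line_sqr (x t) (x s) w1).
  rewrite -/P; rewrite enorm_sqr in Kst.
  have KP : 0 <= K * dotv P P by rewrite mulr_ge0 ?dotv_ge0// ltW.
  have := ltrXn2r 2 KP Kst; rewrite !exprMn -!natrX /=; lra.
have [e e0 psi_gt0] : exists2 e, 0 < e & forall h, 0 < h < e -> 0 < psi h.
  have [e /= e0 He] := cvgr_gt _ psic _ lim_gt0.
  exists e => // h /andP[h0 he]; apply: He; last by rewrite gt_eqF.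
  by rewrite /ball /= sub0r normrN gtr0_norm.
have s_t : 0 < `|s - t| by rewrite normr_gt0 subr_eq0.
(* Small enough for [psi h] to be positive, for t + h to stay below L, and for t + h to differ from
   s. *)
pose h := Num.min e (Num.min (L%:num - t) `|s - t|) / 2.
have [h0 he hL hs] : [/\ 0 < h, h < e, h < L%:num - t & h < `|s - t|].
  have m0 : 0 < Num.min e (Num.min (L%:num - t) `|s - t|).
    by rewrite !lt_min e0 s_t subr_gt0 !andbT; case/andP: tL.
  have : h < Num.min e (Num.min (L%:num - t) `|s - t|) by rewrite /h; lra.
  by rewrite !lt_min => /and3P[? ? ?]; split => //; rewrite /h divr_gt0.
have h00 : h != 0 by rewrite gt_eqF.
have qE : q h = h *: q' h by rewrite /q' scalerA mulfV// scale1r.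
have psih : 0 < psi h by apply: psi_gt0; rewrite h0 he.
have PQ_ge0 : 0 <= K ^+ 2 * (dotv P P * dotv (q' h) (q' h) *
    dotv (P - q h) (P - q h)).
  by rewrite mulr_ge0 ?sqr_ge0// mulr_ge0 ?dotv_ge0// mulr_ge0 ?dotv_ge0.
have DE : dotv P P * dotv (q h) (q h) - dotv P (q h) ^+ 2 =
    h ^+ 2 * (dotv P P * dotv (q' h) (q' h) - dotv P (q' h) ^+ 2).
  by rewrite qE !dotv_lin; ring.
have h2 : 0 < h ^+ 2 by rewrite exprn_gt0.
have D0 : 0 < dotv P P * dotv (q h) (q h) - dotv P (q h) ^+ 2.
  by rewrite DE mulr_gt0//; move: psih PQ_ge0; rewrite /psi; lra.
have [r [xr r0 rE]] := circumradius_le (x t) D0.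
have : ((K^-1)%:E <= r%:E)%E.
  apply: (le_trans xK); apply: le_trans xr; apply: ereal_inf_lbound.
  exists t, s, (h + t); split.
  - by rewrite in_itv /=.
  - by rewrite in_itv /=.
  - by case/andP: tL => tL1 _; rewrite in_itv /= addr_ge0 ?(ltW h0)//= -ltrBrDr.
  - split; [by rewrite eq_sym| |].
      apply/eqP => sht; move: hs; rewrite sht addrK gtr0_norm// ltxx//.
    by rewrite -subr_eq0 addrK.
  - by rewrite /q /P addrC subrK addrC subrK.
rewrite lee_fin -div1r ler_pdivrMr// => Kr.
have Kr2 : 1 <= K ^+ 2 * r ^+ 2.
  by rewrite -exprMn mulrC -(expr1n _ 2) ler_pXn2r ?nnegrE// mulr_ge0// ltW.
have D1 := ler_wpM2l (ltW D0) Kr2.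
have QQ : dotv (q h) (q h) = h ^+ 2 * dotv (q' h) (q' h).
  by rewrite qE !dotv_lin; ring.
have : h ^+ 2 * psi h <= 0.
  have -> : h ^+ 2 * psi h = 4 * (dotv P P * dotv (q h) (q h) - dotv P (q h) ^+ 2)
      - K ^+ 2 * (dotv P P * dotv (q h) (q h) * dotv (P - q h) (P - q h)).
    by rewrite DE QQ /psi; ring.
  rewrite -rE; move: D1; set D := _ - _; lra.
by rewrite leNgt mulr_gt0.
Unshelve. all: by end_near. Qed.

End Thickness.

(** * Quantitative embeddedness and its stability in C^1 *)

Section Separation.
Context {R : realType} {L : {posnum R}}.
Implicit Types (x : C11ia L) (s t u K : R).

(** For fixed t, minimize the distance from x t over [t + d', t + L - d']. At an end of this window
    Taylor gives at least d'/2. At an interior critical point a distance below 1/K would be a strict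
    global minimum, but x t itself is at distance 0. Neither bound depends on t. *)
Lemma curve_separated x K d : 0 < K -> tp_le x K -> 0 < d ->
  exists2 mu, 0 < mu &
    forall t u, d <= u - t <= L%:num - d -> mu <= enorm (x u - x t).
Proof.
move=> K0 xK d0; have [C C0 xC] := curve_arclength_curve x.
(* This makes the Taylor remainder [C * d' ^+ 2] at most half of [d']; [C + 1] keeps the denominator
   positive when [C = 0]. *)
pose d' := Num.min d (2 * (C + 1))^-1.
have C1 : 0 < 2 * (C + 1) by lra.
have d'0 : 0 < d' by rewrite lt_min d0 invr_gt0 C1.
have d'd : d' <= d by rewrite ge_min lexx.
have Cd' : C * d' <= 1 / 2.
  have : (C + 1) * d' <= 1 / 2.
    rewrite (_ : 1 / 2 = (C + 1) * (2 * (C + 1))^-1); last by field; lra.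
    by rewrite ler_pM2l ?ge_min ?lexx ?orbT//; lra.
  by rewrite mulrDl; lra.
have near t s : `|s - t| = d' -> d' / 2 <= enorm (x s - x t).
  move=> st; have := arclength_taylor t s xC C0; rewrite st => h1.
  have := enorm_triangleB (x s - x t) ((s - t) *: derive1 x t) 0.
  rewrite !subr0 enormZ curve_arclength mulr1 st enormB.
  have : C * d' ^+ 2 <= d' / 2.
    by have := ler_wpM2r (ltW d'0) Cd'; rewrite expr2; lra.
  lra.
exists (Num.min K^-1 (d' / 2)); first by rewrite lt_min invr_gt0 K0 divr_gt0.
move=> t u /andP[tu utL].
have uI : u \in `[t + d', t + L%:num - d']%R.
  by rewrite in_itv /=; apply/andP; split; lra.
have tI : t + d' <= t + L%:num - d' by lra.
pose f s := dotv (x s - x t) (x s - x t).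
have fd s : is_derive s 1 f (2 * dotv (x s - x t) (derive1 x s)).
  exact: is_derive_dist_sqr.
have fc : {within `[t + d', t + L%:num - d'], continuous f}.
  by apply: derivable_within_continuous => s _; case: (fd s).
have [m mI mmin] := EVT_min tI fc.
suff : Num.min K^-1 (d' / 2) <= enorm (x m - x t).
  move=> /le_trans; apply; have := mmin u uI.
  by rewrite /f -!enorm_sqr ler_pXn2r ?nnegrE ?enorm_ge0.
rewrite ge_min; move: (mI); rewrite in_itv /= => /andP[].
rewrite le_eqVlt => /orP[/eqP <- _|mt].
  by rewrite near ?orbT// addrAC subrr add0r gtr0_norm.
rewrite le_eqVlt => /orP[/eqP ->|tm].
  rewrite -{2}(curve_periodic x t) near ?orbT//.
  rewrite (_ : _ - _ - _ = - d'); last by lra.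
  by rewrite normrN gtr0_norm.
apply/orP; left; rewrite leNgt; apply/negP => mK.
have mI' : m \in `]t + d', t + L%:num - d'[%R by rewrite in_itv /= mt tm.
have f0 : is_derive m 1 f 0.
  apply: (derive1_at_min tI _ mI') => v vI; last first.
    by apply: mmin; exact: subset_itv_oo_cc.
  by have [] := fd v.
have dm : dotv (x m - x t) (derive1 x m) = 0.
  have := @derive_val _ _ _ _ _ _ _ f0.
  rewrite (@derive_val _ _ _ _ _ _ _ (fd m)) => /eqP.
  by rewrite mulf_eq0 pnatr_eq0 /= => /eqP.
have xtm : x t <> x m.
  by apply: curve_neq; rewrite distrC gtr0_norm; [apply/andP; split|]; clear -mt tm d'0; lra.
have Km : K * enorm (x m - x t) < 1 by rewrite mulrC -ltr_pdivlMr// div1r.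
have := critical_strict_min K0 xK dm Km xtm.
by rewrite subrr enorm0 ltNge enorm_ge0.
Qed.

(** For parameters at most [d] apart, the tangent of [f] stays within q + q < 1 of one unit vector,
    so [f] cannot return to the same point. For all other pairs the points of [x] are at least [mu]
    apart, and each moves by at most [mu / 4]. *)
Lemma C1_close_injective x K : 0 < K -> tp_le x K ->
  exists2 e, 0 < e & forall (f df : R -> 'rV[R]_3),
    (forall t, is_derive t 1 f (df t)) -> (forall t, f (t + L%:num) = f t) ->
    (forall t, enorm (f t - x t) <= e) ->
    (forall t, enorm (df t - derive1 x t) <= e) ->
    {in `[0, L%:num[ &, injective f}.
Proof.
move=> K0 xK; have [C C0 xC] := curve_arclength_curve x.
have [q q0 q1] : exists2 q : R, 0 < q & q + q < 1 by exists (1 / 4); lra.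
pose d := q / (C + 1).
have C1 : 0 < C + 1 by lra.
have d0 : 0 < d by rewrite divr_gt0.
have Cd : C * d <= q.
  have : (C + 1) * d = q by rewrite /d mulrC divfK// gt_eqF.
  by rewrite mulrDl; lra.
have [mu mu0 xmu] := curve_separated K0 xK d0.
exists (Num.min q (mu / 4)); first by rewrite lt_min q0; lra.
move=> f df fd fL fx dfx.
have fx' t : enorm (f t - x t) <= mu / 4.
  by rewrite (le_trans (fx t))// ge_min lexx orbT.
have dfx' t : enorm (df t - derive1 x t) <= q.
  by rewrite (le_trans (dfx t))// ge_min lexx.
have short t u : t < u -> u - t <= d -> f t <> f u.
  move=> tu utd ftu.
  have : enorm (f u - f t - (u - t) *: derive1 x t) <= (q + q) * (u - t).
    apply: (@enorm_increment_affine _ _ df _ _ _ _ (ltW tu)) => // v.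
    rewrite in_itv /= => /andP[tv vu].
    apply: (le_trans (enorm_triangleB (derive1 x v) _ _)).
    have [_ _ /(_ v t)] := xC; rewrite ger0_norm ?subr_ge0// => h1.
    have h2 := dfx' v.
    have h3 : C * (v - t) <= C * d.
      by rewrite ler_wpM2l//; clear -vu utd; lra.
    apply: lerD; first exact: h2.
    exact: (le_trans h1 (le_trans h3 Cd)).
  rewrite ftu subrr sub0r enormN enormZ curve_arclength gtr0_norm ?subr_gt0//.
  by rewrite mulr1 leNgt gtr_pMl ?subr_gt0// q1.
have main t u : 0 <= t -> t < u -> u < L%:num -> f t <> f u.
  move=> t0 tu uL; have [utd|dut] := leP (u - t) d; first exact: short.
  (* The parameters may also be close the other way round the circle; moving t by one period reduces
     this to [short]. *)
  have [utd|] := leP (t + L%:num - u) d.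
    have := @short u (t + L%:num); rewrite fL => h /esym; apply: h => //.
    lra.
  move=> tLu ftu.
  have h1 : mu <= enorm (x u - x t) by apply: xmu; apply/andP; split; lra.
  have h2 := enorm_triangleB (f u) (x u) (x t).
  have h3 := fx' u; have h4 := fx' t; rewrite ftu in h4; rewrite enormB in h3.
  by clear -h1 h2 h3 h4 mu0; lra.
move=> t u; rewrite !in_itv /= => /andP[t0 tL] /andP[u0 uL] ftu.
case: (ltgtP t u) => // h; exfalso.
  exact: (main t u).
by apply: (main u t).
Qed.

End Separation.

(** * Circular arcs and segments with prescribed end tangents *)

Section Arcs.
Context {R : realType}.
Implicit Types (p a b u v w : 'rV[R]_3) (d r l s t : R).

Lemma is_derive_scalel (f : R -> R) (df t : R) v :
  is_derive t 1 f df -> is_derive t 1 (fun s => f s *: v) (df *: v).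
Proof.
move=> fd; apply/is_derive_rowP => i.
have := is_deriveM fd (is_derive_cst (v 0 i : R) t 1).
have -> : f * cst (v 0 i) = (fun s => (f s *: v) 0 i).
  by apply/funext => s; rewrite mxE.
move=> /is_derive_eq; apply; rewrite scaler0 add0r mxE.
by rewrite /GRing.scale /= mulrC.
Qed.

Lemma is_derive_divl (f : R -> R) (df r t : R) :
  is_derive (t / r) 1 f df -> is_derive t 1 (fun s => f (s / r)) (df / r).
Proof.
move=> fd; have gd : is_derive t 1 (fun s : R => s / r) r^-1.
  have := is_deriveM (is_derive_id t 1) (is_derive_cst (r^-1 : R) t 1).
  by move=> /is_derive_eq; apply; rewrite scaler0 add0r /GRing.scale /= mulr1.
have := @is_derive1_comp _ f (fun s => s / r) t _ _ fd gd.
by move=> /is_derive_eq; apply.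
Qed.

Lemma line_arclength_curve p a : enorm a = 1 ->
  arclength_curve 0 (fun t => p + t *: a) (fun=> a).
Proof.
move=> a1; split=> // [t|s t]; last by rewrite subrr enorm0 mul0r.
have := is_deriveD (is_derive_cst p t 1) (is_derive_scalel a (is_derive_id t 1)).
by rewrite add0r scale1r.
Qed.

Lemma enorm_cos_sin u v (x : R) : orthonormal_pair u v ->
  enorm (cos x *: u + sin x *: v) = 1.
Proof.
move=> [u1 v1 uv]; apply: enorm_eqP => //.
rewrite !dotv_lin (dotvC v u) uv (enorm1_dotv u1) (enorm1_dotv v1).
rewrite -(cos2Dsin2 x); ring.
Qed.

Lemma circle_arclength_curve p a v r : 0 < r -> orthonormal_pair a v ->
  arclength_curve r^-1
    (fun t => p + r *: v + (r * cos (t / r)) *: (- v) + (r * sin (t / r)) *: a)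
    (fun t => cos (t / r) *: a + sin (t / r) *: v).
Proof.
move=> r0 av; have rN0 : r != 0 by rewrite gt_eqF.
have cd t : is_derive t 1 (fun s => cos (s / r)) (- sin (t / r) / r).
  exact: is_derive_divl.
have sd t : is_derive t 1 (fun s => sin (s / r)) (cos (t / r) / r).
  exact: is_derive_divl.
split=> [t|t|s t]; last 2 first.
- exact: enorm_cos_sin.
- have ad t' : is_derive t' 1 (fun t => cos (t / r) *: a + sin (t / r) *: v)
      ((- sin (t' / r) / r) *: a + (cos (t' / r) / r) *: v).
    by apply: is_deriveD; exact: is_derive_scalel.
  have adr t' : enorm ((- sin (t' / r) / r) *: a + (cos (t' / r) / r) *: v) <= r^-1.
    have -> : (- sin (t' / r) / r) *: a + (cos (t' / r) / r) *: v =
        r^-1 *: (cos (t' / r) *: v + sin (t' / r) *: (- a)).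
      by apply/rowP => i; rewrite !mxE; ring.
    rewrite enormZ gtr0_norm ?invr_gt0// enorm_cos_sin ?mulr1//.
    by case: av => a1 v1 av0; split => //; rewrite ?enormN// dotvNr dotvC av0 oppr0.
  have main s' t' : t' <= s' ->
      enorm (cos (s' / r) *: a + sin (s' / r) *: v
             - (cos (t' / r) *: a + sin (t' / r) *: v)) <= r^-1 * `|s' - t'|.
    move=> ts; rewrite ger0_norm ?subr_ge0//.
    by apply: (enorm_increment_le ts (fun y _ => ad y)) => y _; exact: adr.
  have [/main//|/ltW/main] := leP t s; by rewrite distrC enormB.
have rcd : is_derive t 1 (fun s => r * cos (s / r)) (- sin (t / r)).
  have := is_deriveZ r (cd t).
  by move=> /is_derive_eq; apply; rewrite /GRing.scale /= mulrC divfK.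
have rsd : is_derive t 1 (fun s => r * sin (s / r)) (cos (t / r)).
  have := is_deriveZ r (sd t).
  by move=> /is_derive_eq; apply; rewrite /GRing.scale /= mulrC divfK.
have := is_deriveD (is_deriveD (is_derive_cst (p + r *: v) t 1)
  (is_derive_scalel (- v) rcd)) (is_derive_scalel a rsd).
by move=> /is_derive_eq; apply; apply/rowP => i; rewrite !mxE; ring.
Qed.

(** The control polygon p, p + d a, p + d (a + b) has two legs of the same length, which is what
    allows a circular arc tangent to both at its ends. The bound |b - a| < 1 keeps the turning angle
    acute; the deviation of the tangent from [a] grows along the arc, so it is largest at the
    end. *)
Lemma arc_exists p a b d : enorm a = 1 -> enorm b = 1 -> 0 < d ->
  enorm (b - a) < 1 ->
  exists l g dg C, [/\ [/\ 0 < l, 0 <= C & arclength_curve C g dg],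
    [/\ g 0 = p, dg 0 = a, g l = p + d *: (a + b) & dg l = b],
    forall t, t \in `[0, l] -> enorm (dg t - a) <= enorm (b - a) &
    is_arc g 0 l].
Proof.
move=> a1 b1 d0 ba1.
have [<-|ab] := eqVneq a b.
  exists (2 * d), (fun t => p + t *: a), (fun=> a), 0.
  split.
  - by split => //; [rewrite mulr_gt0|exact: line_arclength_curve].
  - split => //; first by rewrite scale0r addr0.
    by congr (p + _); apply/rowP => i; rewrite !mxE; ring.
  - by move=> t _; rewrite subrr enorm0.
  - by right; exists p, a; split => // t _; rewrite subr0.
have aa := enorm1_dotv a1; have bb := enorm1_dotv b1.
pose c := dotv a b.
have baE : dotv (b - a) (b - a) = 2 - 2 * c.
  by rewrite !dotv_lin (dotvC b a) aa bb -/c; ring.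
have c_lt1 : c < 1.
  have : 0 < dotv (b - a) (b - a).
    by rewrite -enorm_sqr exprn_gt0// enorm_gt0// subr_eq0 eq_sym.
  by rewrite baE; lra.
have c_gt0 : 0 < c.
  have : enorm (b - a) ^+ 2 < 1 by rewrite exprn_ilt1// ?enorm_ge0.
  by rewrite enorm_sqr baE; lra.
have c11 : -1 <= c <= 1 by apply/andP; split; lra.
pose th := acos c; pose sn := sin th.
have cth : cos th = c by apply: acosK; rewrite in_itv /=.
have sc : c ^+ 2 + sn ^+ 2 = 1 by rewrite -cth; exact: cos2Dsin2.
have csn : 1 - c ^+ 2 = sn ^+ 2 by rewrite -sc addrAC subrr add0r.
have sn0 : 0 < sn.
  rewrite /sn sin_acos// sqrtr_gt0; nra.
have th0 : 0 < th by apply: acos_gt0; case/andP: c11 => -> _.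
have thpi : th <= pi by exact: acos_lepi.
have snN0 : sn != 0 by rewrite gt_eqF.
pose n := sn^-1 *: (b - c *: a).
(* This is d cot(th / 2), the radius for which tangent legs of length d enclose the turning angle
   th. *)
pose r := d * (1 + c) / sn.
have r0 : 0 < r by rewrite divr_gt0// mulr_gt0//; lra.
have rN0 : r != 0 by rewrite gt_eqF.
have an : orthonormal_pair a n.
  split => //.
    apply: enorm_eqP => //; rewrite expr1n /n !dotv_lin aa bb (dotvC b a) -/c.
    rewrite (_ : sn^-1 * _ = sn^-1 * (sn^-1 * (1 - c ^+ 2))); last by ring.
    by rewrite csn; field.
  by rewrite /n !dotv_lin aa -/c mulr1 subrr mulr0.
have bE : b = c *: a + sn *: n.
  by rewrite /n scalerA mulfV// scale1r addrC subrK.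
clearbody n.
exists (r * th),
  (fun t => p + r *: n + (r * cos (t / r)) *: (- n) + (r * sin (t / r)) *: a),
  (fun t => cos (t / r) *: a + sin (t / r) *: n), r^-1.
have rth : r * th / r = th by rewrite mulrC mulKf.
split.
- split; [exact: mulr_gt0|by rewrite invr_ge0 ltW|].
  exact: circle_arclength_curve.
- split.
  + by rewrite mul0r cos0 sin0 mulr1 mulr0 scale0r addr0 scalerN addrK.
  + by rewrite mul0r cos0 sin0 scale1r scale0r addr0.
  + rewrite rth cth -/sn -!addrA; congr (p + _); rewrite bE.
    have e1 : r * sn = d * (1 + c) by rewrite /r divfK.
    have e2 : r * (1 - c) = d * sn.
      apply: (mulIf snN0).
      by rewrite mulrAC e1 -[RHS]mulrA -expr2 -csn; ring.
    apply/rowP => i; rewrite !mxE.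
    rewrite (_ : _ + _ = r * (1 - c) * n 0 i + r * sn * a 0 i); last by ring.
    by rewrite e1 e2; ring.
  + by rewrite rth cth -/sn -bE.
- move=> t; rewrite in_itv /= => /andP[t0 tr].
  have tr' : t / r <= th by rewrite ler_pdivrMr// mulrC.
  have : cos th <= cos (t / r).
    rewrite leNgt ltr_cos ?in_itv/= ?(ltW th0)//= -?leNgt//.
    by rewrite divr_ge0 ?(ltW r0)//= (le_trans tr').
  rewrite cth => ct.
  rewrite -(@ler_pXn2r _ 2)// ?nnegrE ?enorm_ge0// !enorm_sqr baE.
  have -> : dotv (cos (t / r) *: a + sin (t / r) *: n - a)
      (cos (t / r) *: a + sin (t / r) *: n - a) = 2 - 2 * cos (t / r).
    case: an => _ n1 an0; have nn := enorm1_dotv n1.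
    rewrite !dotv_lin (dotvC n a) an0 aa nn; have := cos2Dsin2 (t / r); lra.
  lra.
- left; exists (p + r *: n), (- n), a, r; split => //.
    by case: an => _ n1 an0; split; rewrite ?enormN// dotvNl dotvC an0 oppr0.
  by move=> t _; rewrite subr0.
Qed.

End Arcs.

(** * Gluing and rescaling of arcs *)

Section Gluing.
Context {R : realType}.
Implicit Types (f df g dg : R -> 'rV[R]_3) (a b m s t : R).

Definition glue (T : Type) (f g : R -> T) m : R -> T :=
  fun t => if t <= m then f t else g t.

Lemma glueL (T : Type) (f g : R -> T) m t : t <= m -> glue f g m t = f t.
Proof. by rewrite /glue => ->. Qed.

Lemma glueR (T : Type) (f g : R -> T) m t : f m = g m -> m <= t ->
  glue f g m t = g t.
Proof.
rewrite /glue => fg; case: (leP t m) => // tm mt.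
by have -> : t = m by apply/eqP; rewrite eq_le tm.
Qed.

Lemma is_derive_glue f g m t (l : 'rV[R]_3) : f m = g m ->
  (t <= m -> is_derive t 1 f l) -> (m <= t -> is_derive t 1 g l) ->
  is_derive t 1 (glue f g m) l.
Proof.
move=> fg fl gl; have [tm|mt|tm] := ltgtP t m.
- apply: near_eq_is_derive (fl (ltW tm)).
  near=> s; rewrite glueL//; apply: ltW; near: s; exact: lt_nbhsl.
- apply: near_eq_is_derive (gl (ltW mt)).
  near=> s; rewrite glueR//; apply: ltW; near: s.
  apply/nbhs_ballP; exists (t - m); rewrite /= ?subr_gt0// => y.
  by rewrite /ball /= ltr_norml => /andP[_]; rewrite ltrD2l ltrN2.
- have limE (k : R -> 'rV[R]_3) : is_derive t 1 k l ->
      (fun h => h^-1 *: ((k \o shift t) (h *: 1) - k t)) @ (0 : R)^' --> l.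
    by case=> /cvg_ex[z kz] kl; rewrite -kl /derive (cvg_lim _ kz).
  have [tm' mt'] : t <= m /\ m <= t by rewrite tm.
  have fc := limE _ (fl tm'); have gc := limE _ (gl mt').
  have hc : (fun h => h^-1 *: ((glue f g m \o shift t) (h *: 1) - glue f g m t))
      @ (0 : R)^' --> l.
    apply/cvgrPdist_lt => e e0.
    have fe := (cvgrPdist_lt _ _).1 fc e e0.
    have ge := (cvgrPdist_lt _ _).1 gc e e0.
    near=> h; have [hm|/ltW hm] := leP (h *: 1 + t) m; rewrite /=.
      by rewrite !glueL//; near: h; exact: fe.
    by rewrite !glueR//; near: h; exact: ge.
  apply: DeriveDef; last exact: cvg_lim hc.
  by apply/cvg_ex; exists l.
Unshelve. all: by end_near. Qed.

(** An increment across [m] is split at [m], where the tangents agree. The two parts of |s - t| add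
    up, so the larger of the two constants suffices. *)
Lemma glue_arclength_curve C D f df g dg m :
  arclength_curve C f df -> arclength_curve D g dg -> f m = g m -> df m = dg m ->
  arclength_curve (Num.max C D) (glue f g m) (glue df dg m).
Proof.
move=> [fd df1 dfC] [gd dg1 dgD] fg dfg; split=> [t|t|].
- apply: is_derive_glue => // tm; first by rewrite glueL.
  by rewrite glueR.
- by rewrite /glue; case: ifP.
have main s t : t <= s -> enorm (glue df dg m s - glue df dg m t) <=
    Num.max C D * `|s - t|.
  move=> ts; have [sm|/ltW ms] := leP s m.
    rewrite !glueL// ?(le_trans ts)// (le_trans (dfC _ _))//.
    by rewrite ler_wpM2r// le_max lexx.
  have [tm|/ltW mt] := leP t m; last first.
    rewrite !glueR// (le_trans (dgD _ _))//.
    by rewrite ler_wpM2r// le_max lexx orbT.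
  rewrite glueR// glueL//; apply: (le_trans (enorm_triangleB (dg m) _ _)).
  have -> : `|s - t| = `|s - m| + `|m - t|.
    by rewrite !ger0_norm ?subr_ge0// subrKA.
  rewrite mulrDr lerD//.
    by rewrite (le_trans (dgD _ _))// ler_wpM2r// le_max lexx orbT.
  by rewrite -dfg (le_trans (dfC _ _))// ler_wpM2r// le_max lexx.
move=> s t; have [/main//|/ltW/main] := leP t s.
by rewrite distrC enormB.
Qed.

(** Stretching the parameter by the dilation factor keeps unit speed; the Lipschitz constant of the
    tangent scales like a curvature. *)
Lemma affine_arclength_curve C f df s b : 0 < s -> arclength_curve C f df ->
  arclength_curve (C / s) (fun t => s *: f ((t - b) / s)) (fun t => df ((t - b) / s)).
Proof.
move=> s0 [fd df1 dfC]; split=> [t|//|t u].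
- apply/is_derive_rowP => i.
  have fdi := (is_derive_rowP _ _ _).1 (fd ((t - b) / s)) i.
  have ad : is_derive t 1 (fun t : R => (t - b) / s) s^-1.
    have := is_deriveM (is_deriveB (is_derive_id t 1) (is_derive_cst b t 1))
      (is_derive_cst (s^-1 : R) t 1).
    move=> /is_derive_eq; apply.
    by rewrite scaler0 add0r subr0 /GRing.scale /= mulr1.
  have := is_deriveZ s (@is_derive1_comp _ (fun t => f t 0 i) _ t _ _ fdi ad).
  have -> : s \*: ((fun t => f t 0 i) \o (fun t => (t - b) / s)) =
      (fun t => (s *: f ((t - b) / s)) 0 i).
    by apply/funext => u; rewrite mxE.
  move=> /is_derive_eq; apply.
  by rewrite /GRing.scale /= mulrC divfK// gt_eqF.
- rewrite (le_trans (dfC _ _))// -mulrA.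
  rewrite (_ : (t - b) / s - (u - b) / s = s^-1 * (t - u)); last by ring.
  by rewrite normrM gtr0_norm ?invr_gt0.
Qed.

Lemma is_arc_affine g f a b s c : 0 < s ->
  (forall t, t \in `[s * a + c, s * b + c] -> f t = s *: g ((t - c) / s)) ->
  is_arc g a b -> is_arc f (s * a + c) (s * b + c).
Proof.
move=> s0 fg; have sN0 : s != 0 by rewrite gt_eqF.
have tI t : t \in `[s * a + c, s * b + c] -> (t - c) / s \in `[a, b].
  rewrite !in_itv /= => /andP[at_ tb].
  by rewrite ler_pdivlMr// ler_pdivrMr// ![_ * s]mulrC lerBrDr lerBlDr at_.
case=> [[z [u [v [r [r0 uv gE]]]]]|[p [w [w1 gE]]]]; [left|right].
  exists (s *: z), u, v, (s * r); split => [|//|t tab].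
    exact: mulr_gt0.
  have rN0 : r != 0 by rewrite gt_eqF.
  rewrite fg// gE; last exact: tI.
  have -> : (t - (s * a + c)) / (s * r) = ((t - c) / s - a) / r by field; rewrite rN0 sN0.
  by rewrite !scalerDr !scalerA !mulrA.
exists (s *: p), w; split=> // t tab; rewrite fg// gE; last exact: tI.
rewrite scalerDr scalerA; congr (_ + _ *: _); by field.
Qed.

Lemma is_biarc_affine g f a b s c : 0 < s ->
  (forall t, t \in `[s * a + c, s * b + c] -> f t = s *: g ((t - c) / s)) ->
  is_biarc g a b -> is_biarc f (s * a + c) (s * b + c).
Proof.
move=> s0 fg [gab [m [am mb ga gb]]]; have sN0 : s != 0 by rewrite gt_eqF.
have ab := lt_trans am mb.
have le_aff x y : (s * x + c <= s * y + c) = (x <= y) by rewrite lerD2r ler_pM2l.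
have lt_aff x y : (s * x + c < s * y + c) = (x < y) by rewrite ltrD2r ltr_pM2l.
have affK x : (s * x + c - c) / s = x by rewrite addrK mulrC mulKf.
split.
  rewrite !fg ?in_itv /= ?lexx ?le_aff ?(ltW ab)// !affK.
  by move=> /(scalerI sN0).
exists (s * m + c); rewrite !lt_aff; split => //.
  apply: (is_arc_affine s0 _ ga) => t; rewrite in_itv /= => /andP[h1 h2].
  by apply: fg; rewrite in_itv /= h1 (le_trans h2)// le_aff ltW.
apply: (is_arc_affine s0 _ gb) => t; rewrite in_itv /= => /andP[h1 h2].
by apply: fg; rewrite in_itv /= h2 andbT (le_trans _ h1)// le_aff ltW.
Qed.

End Gluing.

(** * Balanced biarcs for nearly straight data *)

Section BiarcExistence.
Context {R : realType}.
Implicit Types (q w v : 'rV[R]_3) (h e : R).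

(* The joint of the biarc is chosen so that all four legs of the control polygon
   q0, q0 + d t0, q1 - d t1, q1 have the same length d: its middle leg is 2 d w
   with |w| = 1, and d solves 2(1 - t0.t1) d^2 + 2 (v.(t0 + t1)) d = |v|^2. *)
Lemma biarc_legs v t0 t1 h e : enorm t0 = 1 -> enorm t1 = 1 -> 0 < h ->
  0 <= e -> 100 * e <= 1 -> enorm (t1 - t0) <= e ->
  enorm (v - h *: t0) <= e * h ->
  exists d w, [/\ 0 < d, enorm w = 1, v = d *: (t0 + t1) + (2 * d) *: w &
                  enorm (w - t0) <= 14 * e].
Proof.
move=> t01 t11 h0 e0 e1 te ve.
have tt0 := enorm1_dotv t01; have tt1 := enorm1_dotv t11.
pose X := e * h.
have X0 : 0 <= X by rewrite mulr_ge0// ltW.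
have Xh : 100 * X <= h.
  by rewrite /X mulrA -[leRHS]mul1r ler_wpM2r// ltW.
pose V := enorm v.
have hV : enorm (h *: t0) = h by rewrite enormZ t01 mulr1 gtr0_norm.
have V1 : V <= h + X.
  by have := enorm_lerB v (h *: t0); rewrite hV -/V; rewrite -/X in ve; lra.
have V2 : h - X <= V.
  have := enorm_lerB (h *: t0) v; rewrite hV -/V enormB; rewrite -/X in ve; lra.
pose a0 := dotv v t0; pose D := dotv v (t1 - t0).
have [a01 a02] : a0 <= h + X /\ h - X <= a0.
  have : `|dotv (v - h *: t0) t0| <= X.
    by rewrite (le_trans (normr_dotv_le _ _))// t01 mulr1.
  by rewrite dotvDl dotvNl dotvZl tt0 mulr1 -/a0 ler_norml => /andP[]; lra.
have [D1 D2] : - (2 * X) <= D /\ D <= 2 * X.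
  have : `|D| <= V * e.
    by rewrite (le_trans (normr_dotv_le _ _))// ler_wpM2l// enorm_ge0.
  have : V * e <= 2 * X.
    by rewrite (_ : 2 * X = (2 * h) * e) ?ler_wpM2r//; [lra|rewrite /X; ring].
  by move=> h1 h2; move: (le_trans h2 h1); rewrite ler_norml => /andP[].
pose E := dotv (t1 - t0) (t1 - t0).
have E0 : 0 <= E by exact: dotv_ge0.
have E1 : E <= e ^+ 2.
  by rewrite /E -enorm_sqr ler_pXn2r ?nnegrE ?enorm_ge0.
have cE : 2 * dotv t0 t1 = 2 - E.
  by rewrite /E !dotv_lin (dotvC t1 t0) tt0 tt1; ring.
pose A := dotv v v.
have AV : A = V ^+ 2 by rewrite /A -enorm_sqr.
have A0 : 0 < A by rewrite AV exprn_gt0//; lra.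
pose p := dotv v (t0 + t1).
have pE : p = 2 * a0 + D.
  by rewrite /p /a0 /D !dotv_lin; ring.
have p1 : p <= 2 * h + 4 * X by lra.
have p2 : 2 * h - 4 * X <= p by lra.
have p0 : 0 < p by lra.
clearbody D.
pose S := Num.sqrt (p ^+ 2 + A * E).
have SE : S ^+ 2 = p ^+ 2 + A * E.
  by rewrite /S sqr_sqrtr// addr_ge0 ?sqr_ge0// mulr_ge0// ltW.
have S0 : 0 <= S by exact: sqrtr_ge0.
have S1 : p <= S.
  rewrite -(@ler_pXn2r _ 2)// ?nnegrE ?(ltW p0)// SE lerDl mulr_ge0//.
  exact: ltW.
have AE : A * E <= 2 * X * (2 * X).
  have : A * E <= (V * e) ^+ 2.
    by rewrite exprMn AV ler_wpM2l// sqr_ge0.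
  move=> /le_trans; apply.
  have Ve : V * e <= 2 * X.
    by rewrite (_ : 2 * X = (2 * h) * e) ?ler_wpM2r//; [lra|rewrite /X; ring].
  by rewrite -expr2 ler_pXn2r ?nnegrE// mulr_ge0// enorm_ge0.
have S2 : S <= p + X.
  rewrite -(@ler_pXn2r _ 2)// ?nnegrE ?addr_ge0 ?(ltW p0)// SE.
  rewrite sqrrD -addrA lerD2l (le_trans AE)//.
  have : 100 * X * X <= p * X by rewrite ler_wpM2r//; lra.
  by rewrite expr2 -mulr_natl; have := mulr_ge0 X0 X0; lra.
clearbody S.
pose T := p + S.
have T0 : 0 < T by rewrite /T ltr_pwDl.
(* The positive root of E d^2 + 2 p d - A = 0, in the form that avoids dividing by [E], which
   vanishes when t0 = t1. *)
pose d := A / T.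
have dT : d * T = A by rewrite /d divfK// gt_eqF.
have d0 : 0 < d by rewrite divr_gt0.
have quad : A - 2 * d * p - d ^+ 2 * E = 0.
  have : (A - 2 * d * p - d ^+ 2 * E) * T ^+ 2 = 0.
    rewrite (_ : _ * _ = A * T ^+ 2 - 2 * (d * T) * p * T - (d * T) ^+ 2 * E); last by ring.
    rewrite dT /T.
    rewrite (_ : _ - _ - _ = A * (S ^+ 2 - p ^+ 2 - A * E)); last by ring.
    by rewrite SE; ring.
  move=> /eqP; rewrite mulf_eq0 => /orP[/eqP//|].
  by rewrite expf_eq0/= gt_eqF.
have T1 : T <= 4 * h + 9 * X by rewrite /T; lra.
have T2 : 4 * h - 9 * X <= T by rewrite /T; lra.
clearbody T.
have Xhh := mulr_ge0 X0 (ltW h0).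
have XX : 100 * (X * X) <= X * h.
  by rewrite mulrCA ler_wpM2l.
have VV1 : V * V <= (h + X) * (h + X) by rewrite ler_pM ?enorm_ge0.
have hX0 : 0 <= h - X by clear -Xh X0; lra.
have VV2 : (h - X) * (h - X) <= V * V by rewrite ler_pM.
have hT1 : h * T <= h * (4 * h + 9 * X) by rewrite ler_pM2l.
have hT2 : h * (4 * h - 9 * X) <= h * T by rewrite ler_pM2l.
have XT : X * (4 * h - 9 * X) <= X * T by rewrite ler_wpM2l.
have AVV : A = V * V by rewrite AV expr2.
have d1 : 4 * d <= h + 5 * X.
  rewrite -(ler_pM2r T0) -mulrA dT AVV mulrDl.
  clear -Xhh XX VV1 hT2 XT; lra.
have d2 : h - 5 * X <= 4 * d.
  rewrite -(ler_pM2r T0) -mulrA dT AVV mulrBl.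
  clear -Xhh XX VV2 hT1 XT; lra.
clear - t01 h0 e0 e1 te ve tt0 tt1 X0 Xh cE d0 quad d1 d2.
have dN0 : 2 * d != 0 by rewrite gt_eqF//; lra.
exists d, ((2 * d)^-1 *: (v - d *: (t0 + t1))); split => //.
- rewrite enormZ gtr0_norm ?invr_gt0; last by lra.
  suff -> : enorm (v - d *: (t0 + t1)) = 2 * d by rewrite mulVf.
  apply: enorm_eqP; first by lra.
  transitivity (A - 2 * d * p + d ^+ 2 * (2 + 2 * dotv t0 t1)).
    rewrite /A /p !dotv_lin (dotvC t0 v) (dotvC t1 v) (dotvC t1 t0) tt0 tt1; ring.
  rewrite cE -[RHS]addr0 -quad; ring.
- by rewrite scalerA mulfV// scale1r addrC subrK.
have -> : (2 * d)^-1 *: (v - d *: (t0 + t1)) - t0 =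
    (2 * d)^-1 *: (v - h *: t0 + ((h - 4 * d) *: t0 + d *: (t0 - t1))).
  apply: (scalerI dN0); rewrite scalerBr !scalerA mulfV// !scale1r.
  by apply/rowP => i; rewrite !mxE; ring.
rewrite enormZ gtr0_norm ?invr_gt0; last by lra.
rewrite mulrC ler_pdivrMr; last by lra.
apply: (le_trans (enorm_triangle _ _)).
have h1 : enorm ((h - 4 * d) *: t0) <= 5 * X.
  by rewrite enormZ t01 mulr1 ler_norml; apply/andP; split; lra.
have h2 : enorm (d *: (t0 - t1)) <= d * e.
  by rewrite enormZ gtr0_norm// ler_wpM2l ?(ltW d0)// enormB.
have h3 := enorm_triangle ((h - 4 * d) *: t0) (d *: (t0 - t1)).
rewrite -/X in ve.
have h4 : d * e <= X / 2.
  rewrite (_ : X / 2 = (h / 2) * e) ?ler_wpM2r//; last by rewrite /X; ring.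
  by lra.
(* 13/2 = 1 + 5 + 1/2 collects [ve], [h1] and [h4]; [d2] together with 100 X <= h gives 2 d >=
   (13/28) h. *)
have h5 : 13 / 2 * X <= 14 * e * (2 * d).
  rewrite (_ : 13 / 2 * X = 14 * e * (13 / 28 * h)); last by rewrite /X; field.
  by rewrite ler_wpM2l ?mulr_ge0//; clear -d2 Xh h0; lra.
clear -ve h1 h2 h3 h4 h5; lra.
Qed.

(** The two arcs turn t0 into w and w into t1, all legs having length d. The length l is compared
    with h through the chord q1 - q0, which is close both to h t0 and, by integrating the tangent,
    to l t0. *)
Lemma biarc_exists q0 q1 t0 t1 h e : enorm t0 = 1 -> enorm t1 = 1 -> 0 < h ->
  0 <= e -> 100 * e <= 1 -> enorm (t1 - t0) <= e ->
  enorm (q1 - q0 - h *: t0) <= e * h ->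
  exists l g dg C, [/\ [/\ 0 < l, 0 <= C & arclength_curve C g dg],
    [/\ g 0 = q0, dg 0 = t0, g l = q1 & dg l = t1],
    forall t, t \in `[0, l] -> enorm (dg t - t0) <= 30 * e,
    `|l - h| <= 45 * e * h & is_biarc g 0 l].
Proof.
move=> t01 t11 h0 e0 e1 te ve.
have [d [w [d0 w1 vE wt]]] := biarc_legs t01 t11 h0 e0 e1 te ve.
have tw : enorm (t1 - w) <= 15 * e.
  apply: (le_trans (enorm_triangleB t0 _ _)); rewrite [X in _ + X]enormB.
  by rewrite (_ : 15 * e = e + 14 * e) ?lerD//; ring.
have wt_lt1 : enorm (w - t0) < 1 by rewrite (le_lt_trans wt)//; clear -e1; lra.
have tw_lt1 : enorm (t1 - w) < 1 by rewrite (le_lt_trans tw)//; clear -e1; lra.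
have [l1 [g1 [dg1 [C1 [[l10 C10 gc1] [g10 dg10 g1l dg1l] gt1 ga1]]]]] :=
  arc_exists q0 t01 w1 d0 wt_lt1.
have [l2 [g2 [dg2 [C2 [[l20 C20 gc2] [g20 dg20 g2l dg2l] gt2 ga2]]]]] :=
  arc_exists (g1 l1) w1 t11 d0 tw_lt1.
have gc2' := affine_arclength_curve l1 ltr01 gc2; rewrite divr1 in gc2'.
set f2 := (fun t => 1 *: _) in gc2'; set df2 := (fun t => dg2 _) in gc2'.
have f2l : g1 l1 = f2 l1 by rewrite /f2 subrr mul0r g20 scale1r.
have df2l : dg1 l1 = df2 l1 by rewrite /df2 subrr mul0r dg20.
have gc := glue_arclength_curve gc1 gc2' f2l df2l.
have l0 : 0 < l1 + l2 by rewrite addr_gt0.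
have l12 : l1 <= l1 + l2 by rewrite lerDl ltW.
have gl : glue g1 f2 l1 (l1 + l2) = q1.
  rewrite glueR// /f2 addrAC subrr add0r divr1 scale1r g2l g1l.
  rewrite -[RHS](subrK q0) vE; apply/rowP => i; rewrite !mxE; ring.
have gt t : t \in `[0, l1 + l2] -> enorm (glue dg1 df2 l1 t - t0) <= 30 * e.
  rewrite in_itv /= => /andP[t_ge0 tl].
  have [tl1|/ltW tl1] := leP t l1.
    rewrite glueL// (le_trans (gt1 _ _)) ?in_itv /= ?t_ge0//.
    by rewrite (le_trans wt)//; clear -e0; lra.
  rewrite glueR//; apply: (le_trans (enorm_triangleB w _ _)).
  have h1 : enorm (df2 t - w) <= 15 * e.
    rewrite /df2 divr1 (le_trans (gt2 _ _))// in_itv /= subr_ge0 tl1 /=.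
    by rewrite lerBlDl.
  clear -h1 wt e0; lra.
have q01 : q0 <> q1.
  move=> q01; move: ve; rewrite q01 subrr sub0r enormN enormZ t01 mulr1.
  rewrite gtr0_norm// => he.
  have : 100 * e * h <= h by rewrite -[leRHS]mul1r ler_wpM2r// ltW.
  clear -he h0; lra.
exists (l1 + l2), (glue g1 f2 l1), (glue dg1 df2 l1), (Num.max C1 C2); split.
- by split => //; rewrite le_max C10.
- split; [by rewrite glueL ?(ltW l10)|by rewrite glueL ?(ltW l10)|exact: gl|].
  by rewrite glueR// /df2 addrAC subrr add0r divr1.
- exact: gt.
- have [gd _ _] := gc.
  have := enorm_increment_affine (w := t0) (ltW l0) (fun t _ => gd t) gt.
  rewrite gl glueL ?(ltW l10)// g10 subr0.
  set l := l1 + l2 in l0 *; move=> h1.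
  have h2 : `|l - h| <= 30 * e * l + e * h.
    have -> : `|l - h| = enorm ((l - h) *: t0) by rewrite enormZ t01 mulr1.
    rewrite (_ : (l - h) *: t0 = (q1 - q0 - h *: t0) - (q1 - q0 - l *: t0)); last first.
      by rewrite scalerBl; apply/rowP => i; rewrite !mxE; ring.
    apply: (le_trans (enorm_triangle _ _)); rewrite enormN [leRHS]addrC.
    exact: (lerD ve h1).
  have el : 100 * e * l <= l by rewrite -[leRHS]mul1r ler_wpM2r// ltW.
  have eh : 100 * e * h <= h by rewrite -[leRHS]mul1r ler_wpM2r// ltW.
  (* Inserted into [h2], this yields the constant 30 (22/15) + 1 = 45. *)
  have l2h : l <= 22 / 15 * h.
    have := le_trans (ler_norm _) h2; clear -el eh h0 l0; lra.
  have := ler_wpM2l e0 l2h; move: h2; clear; lra.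
- split; first by rewrite glueL ?(ltW l10)// g10 gl.
  exists l1; split => //; first by rewrite ltrDl.
    rewrite -[0](mulr0 1) -[l1](mul1r l1) -[1 * 0]addr0 -[1 * l1]addr0.
    apply: (is_arc_affine ltr01 _ ga1) => t.
    rewrite in_itv /= !addr0 !mul1r => /andP[_ tl].
    by rewrite glueL// subr0 divr1 scale1r.
  have -> : l1 + l2 = 1 * l2 + l1 by rewrite mul1r addrC.
  rewrite -{2}[l1](add0r l1) -[0](mulr0 1).
  apply: (is_arc_affine ltr01 _ ga2) => t.
  rewrite in_itv /= => /andP[tl _].
  by rewrite glueR// -[l1]add0r -(mulr0 1).
Qed.

End BiarcExistence.

(** * Chaining arcs and closing up periodically *)

Section Chains.
Context {R : realType}.
Implicit Types (f df g dg : R -> 'rV[R]_3) (C : R).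

Lemma shift_arclength_curve C f df c : arclength_curve C f df ->
  arclength_curve C (fun t => f (t - c)) (fun t => df (t - c)).
Proof.
move=> /(affine_arclength_curve c ltr01).
rewrite divr1 (_ : (fun t => 1 *: _) = (fun t => f (t - c))).
  rewrite (_ : (fun t => df _) = (fun t => df (t - c)))//.
  by apply/funext => t; rewrite divr1.
by apply/funext => t; rewrite divr1 scale1r.
Qed.

Definition partial_sum (mu : nat -> R) (n : nat) : R := \sum_(i < n) mu i.

Lemma partial_sumS mu n : partial_sum mu n.+1 = partial_sum mu n + mu n.
Proof. by rewrite /partial_sum big_ord_recr. Qed.

Lemma partial_sum_le mu i j : (forall k, 0 < mu k) -> (i <= j)%N ->
  partial_sum mu i <= partial_sum mu j.
Proof.
move=> mu0; elim: j => [|j IH]; first by rewrite leqn0 => /eqP ->.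
rewrite leq_eqVlt ltnS => /orP[/eqP -> //|/IH /le_trans]; apply.
by rewrite partial_sumS lerDl ltW.
Qed.

Lemma chain_arclength_curves (b db : nat -> R -> 'rV[R]_3) (mu C : nat -> R) :
  (forall i, 0 < mu i) -> (forall i, 0 <= C i) ->
  (forall i, arclength_curve (C i) (b i) (db i)) ->
  (forall i, b i (mu i) = b i.+1 0) -> (forall i, db i (mu i) = db i.+1 0) ->
  forall n, exists D g dg, [/\ 0 <= D, arclength_curve D g dg &
    forall i, (i <= n)%N ->
      forall t, t \in `[partial_sum mu i, partial_sum mu i.+1] ->
      g t = b i (t - partial_sum mu i) /\ dg t = db i (t - partial_sum mu i)].
Proof.
move=> mu0 C0 bC bb dbb; elim=> [|n [D [g [dg [D0 gD gE]]]]].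
  exists (C 0%N), (b 0%N), (db 0%N); split=> // i.
  by rewrite leqn0 => /eqP -> t _; rewrite /partial_sum big_ord0 subr0.
pose m := partial_sum mu n.+1.
have mI : m \in `[partial_sum mu n, partial_sum mu n.+1].
  by rewrite in_itv /= lexx andbT partial_sum_le.
have [gm dgm] := gE n (leqnn n) m mI.
have mn : m - partial_sum mu n = mu n by rewrite /m partial_sumS addrAC subrr add0r.
pose g' t := b n.+1 (t - m); pose dg' t := db n.+1 (t - m).
have gm' : g m = g' m by rewrite gm mn bb /g' subrr.
have dgm' : dg m = dg' m by rewrite dgm mn dbb /dg' subrr.
have gC' : arclength_curve (C n.+1) g' dg' by exact: shift_arclength_curve.
exists (Num.max D (C n.+1)), (glue g g' m), (glue dg dg' m); split.
- by rewrite le_max D0.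
- exact: glue_arclength_curve.
- move=> i; rewrite leq_eqVlt => /orP[/eqP -> t|i_n t].
    by rewrite in_itv /= => /andP[mt _]; rewrite !glueR.
  rewrite in_itv /= => /andP[it ti].
  have tm : t <= m by rewrite (le_trans ti)// partial_sum_le.
  by rewrite !glueL//; apply: gE => //; rewrite in_itv /= it.
Qed.

Lemma floor_period (L t : R) : 0 < L ->
  (Num.floor (t / L))%:~R * L <= t < ((Num.floor (t / L))%:~R + 1) * L.
Proof.
move=> L0; have /andP[f1 f2] := floor_itv (t / L).
by rewrite -ler_pdivlMr// f1 /= -ltr_pdivrMr// -[1 in X in _ < X]/(1%:~R) -intrD.
Qed.

Lemma periodize C g dg (L : R) : 0 < L -> 0 <= C -> arclength_curve C g dg ->
  g L = g 0 -> dg L = dg 0 ->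
  exists D f df, [/\ 0 <= D, arclength_curve D f df, forall t, f (t + L) = f t,
    forall t, df (t + L) = df t &
    forall t, t \in `[0, L] -> f t = g t /\ df t = dg t].
Proof.
move=> L0 C0 gC gL dgL.
pose per (h : R -> 'rV[R]_3) t := h (t - (Num.floor (t / L))%:~R * L).
have perE (h : R -> 'rV[R]_3) (k : int) t : h L = h 0 ->
    k%:~R * L <= t <= (k%:~R + 1) * L -> per h t = h (t - k%:~R * L).
  move=> hL /andP[kt tk]; move: tk; rewrite le_eqVlt => /orP[/eqP tE|tk].
    rewrite /per tE mulfK ?gt_eqF// -[1 in X in Num.floor X]/(1%:~R) -intrD.
    rewrite intrKfloor intrD subrr mulrDl mul1r addrAC subrr add0r.
    by rewrite hL.
  rewrite /per; congr (h (t - _%:~R * L)); apply: floor_def.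
  by rewrite ler_pdivlMr// kt /= ltr_pdivrMr// intrD.
have perL (h : R -> 'rV[R]_3) t : per h (t + L) = per h t.
  rewrite /per mulrDl divff ?gt_eqF// -[1 in X in Num.floor X]/(1%:~R).
  rewrite floorDrz ?intr_int// intrKfloor intrD.
  by congr h; ring.
have perglue (h : R -> 'rV[R]_3) (k : int) t : h L = h 0 ->
    (k%:~R - 1) * L <= t <= (k%:~R + 1) * L ->
    per h t = glue (fun t => h (t - (k - 1)%:~R * L)) (fun t => h (t - k%:~R * L))
      (k%:~R * L) t.
  move=> hL /andP[kt tk]; rewrite /glue; case: (leP t (k%:~R * L)) => ktL.
    by apply: perE => //; rewrite intrB kt subrK.
  by apply: perE => //; rewrite (ltW ktL).
have glueC (k : int) : arclength_curve C
   (glue (fun t => g (t - (k - 1)%:~R * L)) (fun t => g (t - k%:~R * L)) (k%:~R * L))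
   (glue (fun t => dg (t - (k - 1)%:~R * L)) (fun t => dg (t - k%:~R * L)) (k%:~R * L)).
  have kE : k%:~R * L - (k - 1)%:~R * L = L by rewrite intrB; ring.
  have := glue_arclength_curve (m := k%:~R * L)
    (shift_arclength_curve ((k - 1)%:~R * L) gC) (shift_arclength_curve (k%:~R * L) gC).
  by rewrite maxxx; apply; rewrite kE subrr.
exists (Num.max C (2 / L)), (per g), (per dg); split.
- by rewrite le_max C0.
- split=> [t||].
  + set k := Num.floor (t / L).
    have /andP[kt tk] := floor_period t L0; rewrite -/k in kt tk.
    have [gd _ _] := glueC k.
    have kt' : (k%:~R - 1) * L < t by rewrite (lt_le_trans _ kt)// ltr_pM2r// ltrBlDr ltrDl.
    rewrite (perglue dg k)// ?(ltW kt') ?(ltW tk)//.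
    apply: near_eq_is_derive (gd t).
    have : \forall s \near t, s \in `](k%:~R - 1) * L, (k%:~R + 1) * L[.
      by apply: near_in_itvoo; rewrite in_itv /= kt'.
    apply: filterS => s; rewrite in_itv /= => /andP[ks sk].
    by rewrite (perglue g k)// (ltW ks) (ltW sk).
  + by move=> t; have [_ dg1 _] := gC; rewrite /per.
  + have main s t : t <= s -> enorm (per dg s - per dg t) <= Num.max C (2 / L) * `|s - t|.
      move=> ts; have [stL|Lst] := leP (s - t) L; last first.
        have [_ dg1 _] := gC.
        apply: (le_trans (enorm_triangle _ _)); rewrite enormN /per !dg1.
        rewrite ger0_norm ?subr_ge0//.
        apply: (@le_trans _ _ (2 / L * (s - t))).
          by rewrite mulrAC ler_pdivlMr// ler_pM2l// ltW.
        by rewrite ler_wpM2r ?subr_ge0// le_max lexx orbT.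
      set k := Num.floor (t / L).
      have /andP[kt tk] := floor_period t L0; rewrite -/k in kt tk.
      have k1 : (k + 1)%:~R = k%:~R + 1 :> R by rewrite intrD.
      have [_ _ gl] := glueC (k + 1).
      have bt : ((k + 1)%:~R - 1) * L <= t <= ((k + 1)%:~R + 1) * L.
        by rewrite k1 addrK kt /=; clear -tk L0; lra.
      have bs : ((k + 1)%:~R - 1) * L <= s <= ((k + 1)%:~R + 1) * L.
        by rewrite k1 addrK (le_trans kt)//=; clear -tk L0 stL; lra.
      rewrite (perglue dg (k + 1) s)// (perglue dg (k + 1) t)//.
      by rewrite (le_trans (gl _ _))// ler_wpM2r// le_max lexx.
    move=> s t; have [/main//|/ltW/main] := leP t s.
    by rewrite distrC enormB.
- exact: perL.
- exact: perL.
- move=> t; rewrite in_itv /= => /andP[t0 tL].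
  by rewrite !(perE _ 0)// ?mul0r ?subr0// add0r mul1r t0.
Qed.

End Chains.

(** * Construction of the recovery curves *)

Section Recovery.
Context {R : realType} {L : {posnum R}}.
Implicit Types (x : C11ia L) (K : R).

Lemma arclength_curve_C11ia (C : R) (f df : R -> 'rV[R]_3) :
  arclength_curve C f df -> (forall t, f (t + L%:num) = f t) ->
  {in `[0, L%:num[ &, injective f} ->
  exists2 gamma : C11ia L, curve gamma = f & derive1 gamma = df.
Proof.
move=> [fd df1 dfC] fL finj.
have dfE : derive1 f = df.
  by apply/funext => t; rewrite derive1E; exact: (@derive_val _ _ _ _ _ _ _ (fd t)).
have flip : [lipschitz derive1 f t | t in [set: R]].
  have pf : ProperFilter (globally ([set: R] `*` [set: R])).
    by apply: (globally_properfilter (a := (0, 0))).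
  apply: (@klipschitzW _ _ _ C) => -[s t] _ /=; rewrite dfE.
  exact: le_trans (mx_norm_le_enorm _) (dfC _ _).
have fder t : derivable f t 1 by have [] := fd t.
have f1 t : enorm (derive1 f t) = 1 by rewrite dfE.
by exists (MkC11ia fL fder flip f1 finj).
Qed.

Lemma periodic_int (T : Type) (f : R -> T) (l : R) : (forall t, f (t + l) = f t) ->
  forall (m : int) t, f (t + m%:~R * l) = f t.
Proof.
move=> fl; have pn (n : nat) t : f (t + n%:R * l) = f t.
  elim: n t => [|n IH] t; first by rewrite mul0r addr0.
  by rewrite -natr1 mulrDl mul1r addrA fl.
case=> n t; first exact: pn.
by rewrite NegzE -{2}(subrK (n.+1%:R * l) t) pn mulrNz mulNr.
Qed.

Lemma partial_sum_locate (mu : nat -> R) n t : 0 <= t -> t < partial_sum mu n ->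
  exists2 i, (i < n)%N & partial_sum mu i <= t <= partial_sum mu i.+1.
Proof.
move=> t0; elim: n => [|n IH]; first by rewrite /partial_sum big_ord0 ltNge t0.
have [/IH[i i_n it] _|nt tn] := ltP t (partial_sum mu n).
  by exists i => //; exact: ltnW.
by exists n => //; rewrite nt ltW.
Qed.

Lemma partial_sum_near (mu : nat -> R) (h e : R) n :
  (forall i, `|mu i - h| <= e * h) ->
  `|partial_sum mu n - n%:R * h| <= e * (n%:R * h).
Proof.
move=> mue; elim: n => [|n IH].
  by rewrite /partial_sum big_ord0 mul0r subrr normr0 mulr0.
rewrite partial_sumS -natr1 mulrDl mul1r opprD addrACA mulrDr.
by rewrite (le_trans (ler_normD _ _))// lerD.
Qed.

(** C h bounds the change of the tangent over one mesh width and, by Taylor, also the relative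
    deviation of the chord from h times the tangent, so it serves as the error [e] of
    [biarc_exists]. *)
Lemma recovery_pieces x (C h : R) : 0 <= C -> 0 < h -> 1000 * (C * h) <= 1 ->
  arclength_curve C x (derive1 x) ->
  exists (l : nat -> R) (g dg : nat -> R -> 'rV[R]_3) (D : nat -> R), forall i,
    [/\ [/\ 0 < l i, 0 <= D i & arclength_curve (D i) (g i) (dg i)],
    [/\ g i 0 = x (i%:R * h), dg i 0 = derive1 x (i%:R * h),
        g i (l i) = x (i.+1%:R * h) & dg i (l i) = derive1 x (i.+1%:R * h)],
    forall t, t \in `[0, l i] ->
      enorm (dg i t - derive1 x (i%:R * h)) <= 30 * (C * h),
    `|l i - h| <= 45 * (C * h) * h & is_biarc (g i) 0 (l i)].
Proof.
move=> C0 h0 Ch xC; have [xd x1 dxC] := xC.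
have e0 : 0 <= C * h by rewrite mulr_ge0// ltW.
have ih i : i.+1%:R * h - i%:R * h = h by rewrite -mulrBl -natr1 addrAC subrr add0r mul1r.
have /choice[l /choice[g /choice[dg /choice[D H]]]] : forall i : nat,
    exists l g dg D, [/\ [/\ 0 < l, 0 <= D & arclength_curve D g dg],
    [/\ g 0 = x (i%:R * h), dg 0 = derive1 x (i%:R * h),
        g l = x (i.+1%:R * h) & dg l = derive1 x (i.+1%:R * h)],
    forall t, t \in `[0, l] ->
      enorm (dg t - derive1 x (i%:R * h)) <= 30 * (C * h),
    `|l - h| <= 45 * (C * h) * h & is_biarc g 0 l].
  move=> i; apply: biarc_exists => //; first by clear -Ch e0; lra.
    by rewrite (le_trans (dxC _ _))// ih gtr0_norm.
  have := arclength_taylor (i%:R * h) (i.+1%:R * h) xC C0.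
  by rewrite ih gtr0_norm// expr2 mulrA.
by exists l, g, dg, D.
Qed.

Lemma C1dist_le x (y : C11ia L) (a b : R) :
  (forall t, enorm (x t - y t) <= a) ->
  (forall t, enorm (derive1 x t - derive1 y t) <= b) -> C1dist x y <= a + b.
Proof.
move=> xa xb; apply: lerD; apply: supnorm_le => t; first exact: xa.
by rewrite derive_diff.
Qed.

Lemma recovery_curve x K : 0 < K -> tp_le x K ->
  exists M h0 : R, [/\ 0 <= M, 0 < h0 & forall n, (0 < n)%N ->
    L%:num / n%:R <= h0 ->
    exists (y : C11ia L) (s : R) (sg : nat -> R),
    [/\ C1dist x y <= M * (L%:num / n%:R), `|s - 1| <= M * (L%:num / n%:R),
        0 < s, biarc_decomposition n y sg &
        forall i, (i < n)%N -> y (sg i) = s *: x (i%:R * (L%:num / n%:R)) /\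
          derive1 y (sg i) = derive1 x (i%:R * (L%:num / n%:R))]].
Proof.
move=> K0 xK; have [C C0 xC] := curve_arclength_curve x.
have [xd x1 dxC] := xC.
have [ep ep0 xinj] := C1_close_injective K0 xK.
have L0 : 0 < L%:num by [].
(* [M1] is the tangent error per mesh width: 30 C within a biarc, plus C times the parameter drift,
   which is at most 180 C L h accumulated at the junctions and 2 h inside the biarc. [M0] adds the
   dilation error at parameter 0 to the integral of the tangent error over one period. *)
pose M1 := 30 * C + C * (180 * C * L%:num + 2).
pose M0 := 90 * C * enorm (x 0) + L%:num * M1.
have M10 : 0 <= M1.
  have h1 := mulr_ge0 C0 (mulr_ge0 C0 (ltW L0)).
  rewrite /M1; clear -h1 C0; lra.
have M00 : 0 <= M0.
  have h1 := mulr_ge0 C0 (enorm_ge0 (x 0)); have h2 := mulr_ge0 (ltW L0) M10.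
  rewrite /M0; clear -h1 h2; lra.
have [M [M_ge0 MM MC]] : exists M, [/\ 0 <= M, M0 + M1 <= M & 90 * C <= M].
  by exists (M0 + M1 + 90 * C); split; clear -M00 M10 C0; lra.
(* The first bound gives C h <= 1/1000, which all numerical estimates below use; the second brings
   the C^1 error below [ep], so that [C1_close_injective] applies. *)
have [h0 [h00 h0C h0M]] : exists h0, [/\ 0 < h0, 1000 * (C + 1) * h0 <= 1 &
    (M + 1) * h0 <= ep].
  have C1 : 0 < 1000 * (C + 1) by clear -C0; lra.
  have M1' : 0 < M + 1 by clear -M_ge0; lra.
  exists (Num.min (1000 * (C + 1))^-1 (ep / (M + 1))); split.
  - by rewrite lt_min invr_gt0 C1 divr_gt0.
  - by rewrite mulrC -ler_pdivlMr// div1r ge_min lexx.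
  - by rewrite mulrC -ler_pdivlMr// ge_min lexx orbT.
exists M, h0; split => // n n0; set h := L%:num / n%:R => hh0.
have nR0 : 0 < n%:R :> R by rewrite ltr0n.
have h_gt0 : 0 < h by rewrite divr_gt0.
have nh : n%:R * h = L%:num by rewrite mulrC divfK// gt_eqF.
pose e := C * h.
have e0 : 0 <= e by rewrite mulr_ge0// ltW.
have e1 : 1000 * e <= 1.
  have h1 := ler_wpM2l C0 hh0; rewrite -/e in h1.
  by clear -h1 h0C h00; lra.
have hep : M * h <= ep.
  have h1 := ler_wpM2l M_ge0 hh0.
  by clear -h1 h0M h00; lra.
have [l [g [dg [D pieces]]]] := recovery_pieces C0 h_gt0 e1 xC.
have lh i : `|l i - h| <= 45 * e * h by have [] := pieces i.
pose Lam := partial_sum l n.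
have LamL : `|Lam - L%:num| <= 45 * e * L%:num.
  by have := partial_sum_near n lh; rewrite nh.
(* The interpolating curve has length [Lam], in general different from L. The dilation is centred at
   the origin, whence the term |x 0| in [M0]. *)
pose s := L%:num / Lam.
have eL : 1000 * (e * L%:num) <= L%:num by rewrite mulrA -[leRHS]mul1r ler_wpM2r.
have Lam0 : L%:num / 2 <= Lam.
  by move: LamL; rewrite ler_norml => /andP[+ _]; clear -eL L0; lra.
have Lam_gt0 : 0 < Lam by rewrite (lt_le_trans _ Lam0)// divr_gt0.
have s0 : 0 < s by rewrite divr_gt0.
have s2 : s <= 2 by rewrite ler_pdivrMr//; clear -Lam0; lra.
have s1 : `|s - 1| <= 90 * e.
  have -> : s - 1 = (L%:num - Lam) / Lam by rewrite mulrBl divff// gt_eqF.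
  rewrite normrM (gtr0_norm (x := Lam^-1)) ?invr_gt0// ler_pdivrMr// distrC.
  apply: (le_trans LamL); have := ler_wpM2l e0 Lam0; clear; lra.
pose mu i := s * l i.
pose b i t := s *: g i ((t - 0) / s); pose db i t := dg i ((t - 0) / s).
have sN0 : s != 0 by rewrite gt_eqF.
have muK i : (mu i - 0) / s = l i by rewrite subr0 /mu mulrC mulKf.
have K0s : (0 - 0) / s = 0 :> R by rewrite subr0 mul0r.
have mu0 i : 0 < mu i by have [[? ? ?] _ _ _ _] := pieces i; rewrite mulr_gt0.
have muh i : `|mu i - h| <= 180 * e * h.
  have -> : mu i - h = s * (l i - h) + (s - 1) * h by rewrite /mu; ring.
  rewrite (le_trans (ler_normD _ _))// (normrM s) (normrM (s - 1)).
  rewrite (gtr0_norm s0) (gtr0_norm h_gt0).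
  rewrite (_ : 180 * e * h = 2 * (45 * e * h) + 90 * e * h); last by ring.
  apply: lerD.
    by apply: ler_pM; [exact: ltW|exact: normr_ge0|exact: s2|exact: lh].
  by apply: ler_wpM2r; [exact: ltW|exact: s1].
have bC i : arclength_curve (D i / s) (b i) (db i).
  by have [[? ? ?] _ _ _ _] := pieces i; exact: affine_arclength_curve.
have D0 i : 0 <= D i / s.
  by have [[? ? ?] _ _ _ _] := pieces i; rewrite divr_ge0// ltW.
have b0 i : b i 0 = s *: x (i%:R * h).
  by rewrite /b K0s; have [_ [-> _ _ _] _ _ _] := pieces i.
have db0 i : db i 0 = derive1 x (i%:R * h).
  by rewrite /db K0s; have [_ [_ -> _ _] _ _ _] := pieces i.
have bmu i : b i (mu i) = b i.+1 0.
  by rewrite b0 /b muK; have [_ [_ _ -> _] _ _ _] := pieces i.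
have dbmu i : db i (mu i) = db i.+1 0.
  by rewrite db0 /db muK; have [_ [_ _ _ ->] _ _ _] := pieces i.
(* Pieces 0 to n are chained, one more than a period holds, so that the values at [sg n = L] can be
   read off as the start of piece n. *)
have [E [G [dG [E0 GE Gb]]]] := chain_arclength_curves mu0 D0 bC bmu dbmu n.
pose sg := partial_sum mu.
have sg0 : sg 0%N = 0 by rewrite /sg /partial_sum big_ord0.
have sgn : sg n = L%:num.
  rewrite /sg /partial_sum -mulr_sumr -/(partial_sum l n) -/Lam /s divfK//.
  by rewrite gt_eqF.
have sgI i : (i <= n)%N -> sg i \in `[partial_sum mu i, partial_sum mu i.+1].
  by move=> i_n; rewrite in_itv /= lexx partial_sumS lerDl ltW.
have Gsg i : (i <= n)%N -> G (sg i) = s *: x (i%:R * h) /\ dG (sg i) = derive1 x (i%:R * h).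
  by move=> i_n; have [-> ->] := Gb i i_n _ (sgI i i_n); rewrite subrr b0 db0.
have x_L : x L%:num = x 0 by rewrite -{1}[L%:num]add0r curve_periodic.
have dx_L : derive1 x L%:num = derive1 x 0.
  by have := derive1_periodicz x 1 0; rewrite add0r mul1r.
have [GL dGL] : G L%:num = G 0 /\ dG L%:num = dG 0.
  rewrite -sg0 -sgn; have [-> ->] := Gsg n (leqnn n).
  by have [-> ->] := Gsg 0%N (leq0n n); rewrite nh mul0r x_L dx_L.
have [E' [f [df [E'0 fE fL dfL fG]]]] := periodize L0 E0 GE GL dGL.
have [fd df1 dfE] := fE.
have sg_itv i : (i <= n)%N -> sg i \in `[0, L%:num].
  by move=> i_n; rewrite in_itv /= -{1}sg0 -sgn !partial_sum_le.
have eh : 1000 * (e * h) <= h by rewrite mulrA -[leRHS]mul1r ler_wpM2r// ltW.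
(* Since h = L / n, these are exactly the two length conditions of the class B_n. *)
have muh2 i : h / 2 <= mu i <= 2 * h.
  have := muh i; rewrite ler_norml => /andP[h1 h2].
  by apply/andP; split; clear -h1 h2 eh h_gt0; lra.
have fpiece i t : (i < n)%N -> sg i <= t -> t <= sg i.+1 ->
    f t = s *: g i ((t - sg i) / s) /\ df t = dg i ((t - sg i) / s).
  move=> i_n it ti; have tL : t \in `[0, L%:num].
    move: (sg_itv i (ltnW i_n)) (sg_itv i.+1 i_n); rewrite !in_itv /=.
    by move=> /andP[h1 _] /andP[_ h2]; rewrite (le_trans h1 it) (le_trans ti h2).
  have [-> ->] := fG t tL.
  have [|-> ->] := Gb i (ltnW i_n) t; first by rewrite in_itv /= it ti.
  by rewrite /b /db subr0.
have dfx t : enorm (df t - derive1 x t) <= M1 * h.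
  have [m] := period_reduce (L := L) t.
  rewrite -(periodic_int dfL m t) -(derive1_periodicz x m t).
  move: (t + _) => u /andP[u0 uL].
  have [|i i_n /andP[iu ui]] := @partial_sum_locate mu n u u0.
    by rewrite -/(sg n) sgn.
  have [_ ->] := fpiece i u i_n iu ui.
  have h1 : enorm (dg i ((u - sg i) / s) - derive1 x (i%:R * h)) <= 30 * e.
    have [_ _ H _ _] := pieces i; apply: H.
    have us : u - sg i <= l i * s.
      by rewrite lerBlDl mulrC; move: ui; rewrite /sg partial_sumS.
    rewrite in_itv /= (ler_pdivrMr _ _ s0) us andbT.
    by apply: divr_ge0; [rewrite subr_ge0|exact: ltW].
  have ihL : i%:R * h <= L%:num.
    by rewrite -nh ler_wpM2r ?(ltW h_gt0)// ler_nat ltnW.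
  have h2 : `|sg i - i%:R * h| <= 180 * e * L%:num.
    apply: (le_trans (partial_sum_near i muh)).
    by apply: ler_wpM2l; [clear -e0; lra|exact: ihL].
  have h3 : `|i%:R * h - u| <= 180 * e * L%:num + 2 * h.
    have /andP[_ h4] := muh2 i.
    have h5 : u - sg i <= 2 * h.
      by rewrite lerBlDl (le_trans ui)// partial_sumS lerD2l.
    have iu' : 0 <= u - sg i by rewrite subr_ge0.
    move: h2; rewrite !ler_norml => /andP[h6 h7].
    by apply/andP; split; clear -h5 h6 h7 iu' h_gt0; lra.
  apply: (le_trans (enorm_triangleB (derive1 x (i%:R * h)) _ _)).
  have h4 := le_trans (dxC (i%:R * h) u) (ler_wpM2l C0 h3).
  by apply: (le_trans (lerD h1 h4)); rewrite /M1 /e; clear; lra.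
have f0 : f 0 = s *: x 0.
  have z0 : 0 \in `[0, L%:num] by rewrite in_itv /= lexx ltW.
  have [-> _] := fG 0 z0; have [Ge _] := Gsg 0%N (leq0n n).
  by move: Ge; rewrite sg0 mul0r.
have fx t : enorm (f t - x t) <= M0 * h.
  have [m] := period_reduce (L := L) t.
  rewrite -(periodic_int fL m t) -(curve_periodicz x m t).
  move: (t + _) => u /andP[u0 uL].
  have fxd (v : R) : is_derive v 1 (fun v => f v - x v) (df v - derive1 x v).
    exact: (is_deriveB (fd v) (xd v)).
  have h1 := enorm_increment_le u0 (fun v _ => fxd v) (fun v _ => dfx v).
  have h2 : enorm (f 0 - x 0) <= 90 * e * enorm (x 0).
    rewrite f0 -{2}[x 0]scale1r -scalerBl enormZ.
    by apply: ler_wpM2r; [exact: enorm_ge0|exact: s1].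
  have h3 : M1 * h * (u - 0) <= M1 * h * L%:num.
    apply: ler_wpM2l; first by rewrite mulr_ge0// ltW.
    by rewrite subr0 ltW.
  have h4 := enorm_triangleB (f 0 - x 0) (f u - x u) 0.
  rewrite !subr0 in h4.
  apply: (le_trans h4); apply: (le_trans (lerD (le_trans h1 h3) h2)).
  by rewrite /M0 /e; clear; lra.
have MMh : M0 * h + M1 * h <= M * h by rewrite -mulrDl ler_wpM2r// ltW.
have M0h : 0 <= M0 * h by rewrite mulr_ge0// ltW.
have M1h : 0 <= M1 * h by rewrite mulr_ge0// ltW.
have finj : {in `[0, L%:num[ &, injective f}.
  apply: (xinj f df fd fL) => t.
    by apply: (le_trans (fx t)); clear -hep MMh M1h; lra.
  by apply: (le_trans (dfx t)); clear -hep MMh M0h; lra.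
have [y yf ydf] := arclength_curve_C11ia fE fL finj.
exists y, s, sg; split.
- apply: le_trans MMh; apply: C1dist_le => t.
    by rewrite yf enormB; exact: fx.
  by rewrite ydf ?yf enormB; exact: dfx.
- apply: (le_trans s1); rewrite /e mulrA; apply: ler_wpM2r; last exact: MC.
  exact: ltW.
- exact: s0.
- split.
  + by rewrite sg0 add0r sgn.
  + by move=> i _; rewrite /sg partial_sumS ltrDl.
  + move=> i i_n; have [_ _ _ _ gi] := pieces i.
    have -> : sg i.+1 = s * l i + sg i by rewrite /sg partial_sumS addrC.
    rewrite -{1}[sg i]add0r -{1}(mulr0 s) yf.
    apply: (is_biarc_affine s0 _ gi) => t; rewrite in_itv /= mulr0 add0r => /andP[it ti].
    have [|-> //] := fpiece i t i_n it _.
    by rewrite /sg partial_sumS addrC.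
  + move=> i _; have -> : sg i.+1 - sg i = mu i.
      by rewrite /sg partial_sumS addrAC subrr add0r.
    have /andP[h1 h2] := muh2 i.
    rewrite -mulrA h2 andbT (le_trans _ h1)// /h invfM mulrA mulrAC.
    exact: lexx.
- move=> i i_n; rewrite ydf ?yf.
  have si : sg i <= sg i.+1 by rewrite /sg partial_sumS lerDl ltW.
  have [-> ->] := fpiece i (sg i) i_n (lexx _) si; rewrite subrr mul0r.
  by have [_ [-> -> _ _] _ _ _] := pieces i.
Qed.

End Recovery.

(** * Bounds on the discrete energy and on its rescaled root *)

Section EnergyBounds.
Context {R : realType} {L : {posnum R}}.
Implicit Types (x y : C11ia L) (K : R).

Lemma bernoulli_ge (a : R) n : 0 <= a -> 1 + n%:R * a <= (1 + a) ^+ n.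
Proof.
move=> a0; elim: n => [|n IH]; first by rewrite mul0r addr0 expr0.
rewrite exprSr; have a1 : 0 <= 1 + a by rewrite addr_ge0.
apply: (le_trans _ (ler_wpM2r a1 IH)); rewrite -natr1.
by have := mulr_ge0 (ler0n R n) (mulr_ge0 a0 a0); lra.
Qed.

(** The cube of Bernoulli's inequality gives (1 + a)^(3n) >= n^3 a^3, which exceeds 4 n^2 once n >=
    4 / a^3; a square would only match the order n^2. *)
Lemma expr_dominates_sqr K (a : R) : 0 < K -> 0 < a ->
  exists N, forall n, (N <= n)%N -> 4 * n%:R ^+ 2 * K ^+ n <= (K * (1 + a) ^+ 3) ^+ n.
Proof.
move=> K0 a0; have a3 : 0 < a ^+ 3 by rewrite exprn_gt0.
have [N /ltW HN] : exists N : nat, 4 / a ^+ 3 < N%:R.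
  have := archi_boundP (ltW (divr_gt0 (ltr0n R 4) a3)).
  by exists (Num.bound (4 / a ^+ 3)).
exists N => n Nn; rewrite exprMn mulrC ler_pM2l ?exprn_gt0//.
rewrite -exprM mulnC exprM.
have na : n%:R * a <= (1 + a) ^+ n.
  by apply: (le_trans _ (bernoulli_ge n (ltW a0))); rewrite lerDr.
have na0 : 0 <= n%:R * a by rewrite mulr_ge0// ltW.
have n3 : (n%:R * a) ^+ 3 <= ((1 + a) ^+ n) ^+ 3.
  by rewrite lerXn2r// nnegrE// (le_trans na0).
apply: (le_trans _ n3).
rewrite (_ : (n%:R * a) ^+ 3 = n%:R ^+ 2 * (n%:R * a ^+ 3)); last by ring.
rewrite mulrC ler_wpM2l ?sqr_ge0//.
rewrite -ler_pdivrMr//; apply: (le_trans HN); by rewrite ler_nat.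
Qed.

(** For unit w, squaring turns the inequality into positivity of a polynomial in (q - p, w), an open
    condition. The sup-norm ball that this provides contains the Euclidean one. *)
Lemma tp_gt_open K (p w q : 'rV[R]_3) : 0 <= K -> enorm w = 1 ->
  K * enorm (q - p) ^+ 2 < 2 * dist_line p w q ->
  exists2 e, 0 < e & forall p' w' q', enorm w' = 1 ->
    enorm (q' - p' - (q - p)) < e -> enorm (w' - w) < e ->
    K * enorm (q' - p') ^+ 2 < 2 * dist_line p' w' q'.
Proof.
move=> K0 w1 Kpq; set P := q - p in Kpq *.
pose Phi (z : 'rV[R]_3 * 'rV[R]_3) := 4 * (dotv z.1 z.1 - dotv z.1 z.2 * dotv z.1 z.2) -
   K ^+ 2 * (dotv z.1 z.1 * dotv z.1 z.1).
have PhiE p' w' q' : enorm w' = 1 -> Phi (q' - p', w') =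
    (2 * dist_line p' w' q') ^+ 2 - (K * enorm (q' - p') ^+ 2) ^+ 2.
  by move=> w'1; rewrite !exprMn enorm_sqr dist_line_sqr// /Phi /=; ring.
have Phi0 : 0 < Phi (P, w).
  have KP0 : 0 <= K * enorm P ^+ 2 by apply: mulr_ge0 => //; exact: sqr_ge0.
  by rewrite PhiE// subr_gt0 -/P; exact: (ltrXn2r 2 KP0 Kpq).
have Phic : Phi z @[z --> (P, w)] --> Phi (P, w).
  have c1 : (z.1 : 'rV[R]_3) @[z --> (P, w)] --> P by exact: cvg_fst.
  have c2 : (z.2 : 'rV[R]_3) @[z --> (P, w)] --> w by exact: cvg_snd.
  have d1 := cvg_dotv c1 c1; have d2 := cvg_dotv c1 c2.
  apply: cvgB; apply: cvgMr.
    by apply: cvgB; [exact: d1|apply: cvgM; exact: d2].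
  by apply: cvgM; exact: d1.
have nb : nbhs (P, w) [set z | 0 < Phi z] by exact: (cvgr_gt _ Phic _ Phi0).
have [e /= e0 He] := (nbhs_ballP _ _).1 nb.
exists e; [exact: e0|move=> p' w' q' w'1 Pe we].
have : 0 < Phi (q' - p', w').
  apply: He; split; rewrite /= -ball_normE /= -normrN opprB.
    by rewrite (le_lt_trans (mx_norm_le_enorm _)).
  by rewrite (le_lt_trans (mx_norm_le_enorm _)).
have d0 := dist_line_ge0 p' q' w'1.
have a0 : 0 <= K * enorm (q' - p') ^+ 2 by apply: mulr_ge0; [exact: K0|exact: sqr_ge0].
have b0 : 0 <= 2 * dist_line p' w' q' by apply: mulr_ge0; [exact: ler0n|exact: d0].
by rewrite (PhiE _ _ _ w'1) subr_gt0 ltr_pXn2r ?nnegrE.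
Qed.

Lemma C1dist_ge x y t : enorm (x t - y t) <= C1dist x y /\
  enorm (derive1 x t - derive1 y t) <= C1dist x y.
Proof.
have h1 := supnorm_ub t (diff_bounded x y).
have h2 := supnorm_ub t (derive_diff_bounded x y).
rewrite derive_diff in h2; split; rewrite /C1dist /C1norm.
  by rewrite (le_trans h1)// lerDl (le_trans (enorm_ge0 _) h2).
by rewrite (le_trans h2)// lerDr (le_trans (enorm_ge0 _) h1).
Qed.

(** The upper length bound of B_n makes the junctions a net of mesh 2 L / n on the circle R/LZ. *)
Lemma decomposition_locate n y sg (d t : R) : (0 < n)%N ->
  biarc_decomposition n y sg -> 2 * L%:num / n%:R < d ->
  exists i (m : int), (i < n)%N /\ `|sg i + m%:~R * L%:num - t| < d.
Proof.
move=> n0 [sgn sglt _ sgle] nd.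
have [m /andP[t0 tL]] := period_reduce (L := L) (t - sg 0%N).
pose u := t + m%:~R * L%:num.
have [i i_n /andP[iu ui]] : exists2 i, (i < n)%N & sg i <= u <= sg i.+1.
  have un : u < sg n by rewrite sgn /u; clear -tL; lra.
  have u0 : sg 0%N <= u by rewrite /u; clear -t0; lra.
  elim: (n) un => [|k IH]; first by rewrite ltNge u0.
  have [/IH[i ik iu] _|ku uk] := ltP u (sg k); first by exists i => //; exact: ltnW.
  by exists k => //; rewrite ku ltW.
exists i, (- m); split => //; have /andP[_ h1] := sgle i i_n.
rewrite distrC ger0_norm; last by rewrite mulrNz /u in iu *; clear -iu; lra.
by apply: le_lt_trans nd; move: ui h1; rewrite mulrNz /u; clear; lra.
Qed.

(** The other summands are nonnegative and are dropped; the lower length bound of B_n controls both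
    weights of the remaining one. *)
Lemma tp_sum_ge n y sg K i j : (0 < n)%N -> biarc_decomposition n y sg ->
  0 < K -> (i < n)%N -> (j < n)%N -> i != j ->
  K * enorm (y (sg i) - y (sg j)) ^+ 2 <
    2 * dist_line (y (sg j)) (derive1 y (sg j)) (y (sg i)) ->
  K ^+ n * (L%:num / (2 * n%:R)) ^+ 2 <= tp_sum n n%:R y sg.
Proof.
move=> n0 [_ sglt _ sgle] K0 i_n j_n ij Kij.
pose F (i j : nat) : R := (2 * dist_line (y (sg j)) (derive1 y (sg j)) (y (sg i))
       / enorm (y (sg i) - y (sg j)) ^+ 2) `^ n%:R
    * (sg i.+1 - sg i) * (sg j.+1 - sg j).
have F0 (k l : 'I_n) : 0 <= F k l.
  by rewrite !mulr_ge0 ?powR_ge0// subr_ge0 ltW// sglt.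
have -> : tp_sum n n%:R y sg = \sum_(k < n) \sum_(l < n | l != k) F k l by [].
pose i' := Ordinal i_n; pose j' := Ordinal j_n.
have ji' : j' != i' by rewrite -val_eqE /= eq_sym.
apply: (@le_trans _ _ (F i j)); last first.
  rewrite (bigD1 i')//= (bigD1 j')//= -addrA lerDl addr_ge0//.
    by apply: sumr_ge0 => l _; exact: (F0 i' l).
  by apply: sumr_ge0 => k _; apply: sumr_ge0 => l _; exact: F0.
have len0 : 0 <= L%:num / (2 * n%:R) by rewrite divr_ge0// mulr_ge0.
have /andP[li _] := sgle i i_n; have /andP[lj _] := sgle j j_n.
move: len0 li lj; move: (L%:num / (2 * n%:R)) => len len0 li lj.
rewrite /F (expr2 len) (mulrA _ len len).
have Kn0 : 0 <= K ^+ n by rewrite exprn_ge0// ltW.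
apply: ler_pM; [exact: mulr_ge0|exact: len0| |exact: lj].
apply: ler_pM; [exact: Kn0|exact: len0| |exact: li].
have P0 : 0 < enorm (y (sg i) - y (sg j)) ^+ 2.
  rewrite lt_neqAle sqr_ge0 andbT eq_sym sqrf_eq0; apply/eqP => P0.
  have yij := enorm_eq0 P0; move: Kij.
  rewrite dist_lineE ?curve_arclength// yij enorm0 dotv0l dotv0l expr0n subrr sqrtr0.
  by rewrite !mulr0 ltxx.
rewrite powR_mulrn.
  apply: lerXn2r; rewrite ?nnegrE ?(ltW K0)//.
    by rewrite divr_ge0 ?(ltW P0)// mulr_ge0// dist_line_ge0// curve_arclength.
  by rewrite ler_pdivlMr// ltW.
by rewrite divr_ge0 ?(ltW P0)// mulr_ge0// dist_line_ge0// curve_arclength.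
Qed.

(** The exponent (n - 2) / n of the prefactor complements the 2 / n that comes from the two length
    weights. *)
Lemma powR_rescale n K : (0 < n)%N -> 0 < K ->
  L%:num `^ ((n%:R - 2) / n%:R) * (K ^+ n * L%:num ^+ 2) `^ n%:R^-1 = L%:num * K.
Proof.
move=> n0 K0; have nN0 : n%:R != 0 :> R by rewrite pnatr_eq0 -lt0n.
have K_ge0 := ltW K0; have L_ge0 : 0 <= L%:num by [].
rewrite powRM ?exprn_ge0//.
rewrite -!powR_mulrn// -!powRrM mulfV// powRr1//.
rewrite mulrCA mulrC; congr (_ * _); rewrite -powRD; last first.
  by apply/implyP => _; rewrite gt_eqF.
by rewrite -mulrDl subrK mulfV// powRr1.
Qed.

Lemma rescaled_energy_ge n K (E : \bar R) : (0 < n)%N -> 0 < K ->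
  ((K ^+ n * L%:num ^+ 2)%:E <= E)%E ->
  ((L%:num * K)%:E <= (L%:num `^ ((n%:R - 2) / n%:R))%:E * E `^ (n%:R^-1))%E.
Proof.
move=> n0 K0 KE; have KL0 : 0 <= K ^+ n * L%:num ^+ 2.
  by rewrite mulr_ge0// exprn_ge0// ltW.
rewrite -(powR_rescale n0 K0) EFinM -poweR_EFin lee_wpmul2l//.
  by rewrite lee_fin powR_ge0.
have r0 : 0 <= n%:R^-1 :> R by rewrite invr_ge0.
apply: (gt0_ler_poweR r0 _ _ KE); rewrite in_itv /= leey andbT ?lee_fin//.
by rewrite (le_trans _ KE)// lee_fin.
Qed.

Lemma rescaled_energy_le n K (E : \bar R) : (0 < n)%N -> 0 < K -> (0 <= E)%E ->
  (E <= (K ^+ n * L%:num ^+ 2)%:E)%E ->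
  ((L%:num `^ ((n%:R - 2) / n%:R))%:E * E `^ (n%:R^-1) <= (L%:num * K)%:E)%E.
Proof.
move=> n0 K0 E0 KE; have KL0 : 0 <= K ^+ n * L%:num ^+ 2.
  by rewrite mulr_ge0// exprn_ge0// ltW.
rewrite -(powR_rescale n0 K0) EFinM -poweR_EFin lee_wpmul2l//.
  by rewrite lee_fin powR_ge0.
have r0 : 0 <= n%:R^-1 :> R by rewrite invr_ge0.
by apply: (gt0_ler_poweR r0 _ _ KE); rewrite in_itv /= leey andbT ?lee_fin.
Qed.

End EnergyBounds.

(** * Comparison principles in the extended reals *)

Section LimitInequalities.
Context {R : realType}.
Local Open Scope ereal_scope.

Lemma limn_einf_ge (u : nat -> \bar R) (l : \bar R) :
  (\forall n \near \oo, l <= u n) -> l <= limn_einf u.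
Proof.
move=> [N _ HN]; rewrite limn_einf_lim.
apply: lime_ge; first exact: is_cvg_einfs.
near=> n; apply: le_ereal_inf_tmp => _ [k /= nk <-].
by apply: HN => /=; apply: leq_trans nk; near: n; exists N.
Unshelve. all: by end_near. Qed.

Lemma limn_esup_le (u : nat -> \bar R) (l : \bar R) :
  (\forall n \near \oo, u n <= l) -> limn_esup u <= l.
Proof.
move=> [N _ HN]; rewrite limn_esup_lim.
apply: lime_le; first exact: is_cvg_esups.
near=> n; apply: ge_ereal_sup => _ [k /= nk <-].
by apply: HN => /=; apply: leq_trans nk; near: n; exists N.
Unshelve. all: by end_near. Qed.

(** Testing against positive reals below [a] treats finite and infinite ropelength alike and makes K
    = r / L positive. *)
Lemma le_ereal_pos (a b : \bar R) : 0 <= b ->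
  (forall r : R, (0 < r)%R -> r%:E < a -> r%:E <= b) -> a <= b.
Proof.
move=> b0 H; rewrite leNgt; apply/negP => ba.
case: b b0 H ba => [b b0 H ba|_ _|//]; last by rewrite ltNge leey.
rewrite lee_fin in b0.
have [r br ra] : exists2 r, (b < r)%R & r%:E < a.
  case: a H ba => [a| |] H //=.
    rewrite lte_fin => ba; exists ((a + b) / 2)%R; first by lra.
    by rewrite lte_fin; lra.
  by move=> _; exists (b + 1)%R; [rewrite ltrDl|exact: ltry].
by have := H r (le_lt_trans b0 br) ra; rewrite lee_fin leNgt br.
Qed.

End LimitInequalities.

(** * Eventual lower and upper bounds for the rescaled energies *)

Section GammaBounds.
Context {R : realType} {L : {posnum R}}.
Implicit Types (x y : C11ia L) (K : R).

Lemma circumradius_ge0 (p q r : 'rV[R]_3) : (0 <= circumradius p q r)%E.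
Proof.
apply: le_ereal_inf_tmp => _ [z [a [b /= [<- _ _]]] <-].
by rewrite lee_fin enorm_ge0.
Qed.

Lemma thickness_ge0 x : (0 <= thickness x)%E.
Proof.
by apply: le_ereal_inf_tmp => _ [s [t [u [_ _ _ _ ->]]]]; exact: circumradius_ge0.
Qed.

(** In the degenerate cases both sides agree by the conventions for inverses: zero thickness gives
    ropelength +oo and both fail, infinite thickness gives 0 and both hold. *)
Lemma ropelength_leP x K : 0 < K ->
  (ropelength x <= (L%:num * K)%:E)%E <-> ((K^-1)%:E <= thickness x)%E.
Proof.
move=> K0; rewrite /ropelength; have := thickness_ge0 x.
have L0 : 0 < L%:num by [].
case: (thickness x) => [T| |] //= T0; last first.
  split => _; first exact: leey.
  by rewrite invey mule0 lee_fin mulr_ge0// ltW.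
rewrite lee_fin in T0; have [->|TN0] := eqVneq T 0.
  rewrite inve0 gt0_muley ?lte_fin// leye_eq lee_fin.
  by split => //; rewrite leNgt invr_gt0 K0.
have T_gt0 : 0 < T by rewrite lt_neqAle eq_sym TN0.
rewrite inver (negbTE TN0) -EFinM !lee_fin ler_pM2l//.
by rewrite -[T^-1]div1r -[K^-1]div1r !ler_pdivrMr// mulrC.
Qed.

Lemma tp_le_mono x K K' : K <= K' -> tp_le x K -> tp_le x K'.
Proof.
move=> KK xK s t; apply: (le_trans (xK s t)).
by rewrite ler_wpM2r// sqr_ge0.
Qed.

Lemma tp_le_lim x K : (forall K', K < K' -> tp_le x K') -> tp_le x K.
Proof.
move=> H s t; set a := enorm _ ^+ 2; have a0 : 0 <= a by exact: sqr_ge0.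
apply/ler_addgt0Pr => e e0.
have a1 : 0 < a + 1 by rewrite ltr_wpDl.
have KK : K < K + e / (a + 1) by rewrite ltrDl divr_gt0.
apply: (le_trans (H _ KK s t)); rewrite -/a mulrDl lerD2l.
by rewrite mulrAC ler_pdivrMr// ler_pM2l// lerDl.
Qed.

(** The form K (1 + a)^3 is the one [expr_dominates_sqr] consumes. As a <= 1, one has (1 + a)^3 <= 1
    + 7 a, whence the denominator 7 K. *)
Lemma not_tp_le_gt x K : 0 < K -> ~ tp_le x K ->
  exists2 a, 0 < a & ~ tp_le x (K * (1 + a) ^+ 3).
Proof.
move=> K0 nx; have [K' KK' nx'] : exists2 K', K < K' & ~ tp_le x K'.
  apply: contrapT => H; apply: nx; apply: tp_le_lim => K' KK'.
  by apply: contrapT => nK'; apply: H; exists K'.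
pose a := Num.min 1 ((K' - K) / (7 * K)).
have K7 : 0 < 7 * K by clear -K0; lra.
have a0 : 0 < a by rewrite lt_min ltr01 divr_gt0// subr_gt0.
have a1 : a <= 1 by rewrite ge_min lexx.
have a2 : a * (7 * K) <= K' - K by rewrite -ler_pdivlMr// ge_min lexx orbT.
exists a => // xK; apply: nx'; apply: tp_le_mono xK.
clearbody a.
have aa : a * a <= a by rewrite -[leRHS]mulr1 ler_pM2l.
have aaa : a * a * a <= a by rewrite (le_trans _ aa)// -[leRHS]mulr1 ler_pM2l// mulr_gt0.
have h1 := ler_wpM2l (ltW K0) aa; have h2 := ler_wpM2l (ltW K0) aaa.
by clear -h1 h2 a2; lra.
Qed.

(* A single pair of junctions near a point pair where the tangent-point quotient
   exceeds K already forces the energy up: the factor 4 n^2 lost with the weights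
   is absorbed by the gap between K and K (1 + a)^3. *)
Lemma energy_liminf x K : 0 < K -> ~ tp_le x K ->
  exists2 e, 0 < e & exists N, forall n y, (N <= n)%N -> C1dist x y < e ->
    ((L%:num * K)%:E <=
      (L%:num `^ ((n%:R - 2) / n%:R))%:E * tp_energy n n%:R y `^ (n%:R^-1))%E.
Proof.
move=> K0 nx; have [a a0 nx'] := not_tp_le_gt K0 nx.
set K' := K * (1 + a) ^+ 3 in nx'.
have K'0 : 0 < K' by rewrite mulr_gt0// exprn_gt0// addr_gt0.
have [s [t Kst]] : exists s t, K' * enorm (x s - x t) ^+ 2 <
    2 * dist_line (x t) (derive1 x t) (x s).
  apply: contrapT => H; apply: nx' => s t; rewrite leNgt; apply/negP => h.
  by apply: H; exists s, t.
have [e0 e00 He] := tp_gt_open (ltW K'0) (curve_arclength x t) Kst.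
have [C C0 xC] := curve_arclength_curve x; have [_ _ dxC] := xC.
(* With C^1 distance below [e] and junctions within [e] of s and t, the chord moves by less than 4 e
   and the tangent by less than (1 + C) e, both below [e0]. *)
pose e := e0 / (5 + C).
have C5 : 0 < 5 + C by clear -C0; lra.
have e_gt0 : 0 < e by rewrite divr_gt0.
have eE : (5 + C) * e = e0 by rewrite mulrC divfK// gt_eqF.
have [N1 HN1] := expr_dominates_sqr K0 a0.
have [N2 HN2] : exists N : nat, 2 * L%:num / e < N%:R.
  exists (Num.bound (2 * L%:num / e)); apply: archi_boundP.
  by apply: divr_ge0; [apply: mulr_ge0|exact: ltW].
exists e => //; exists (maxn N1 N2).+1 => n y Nn xy.
have n0 : (0 < n)%N by apply: leq_trans Nn.
have nR0 : 0 < n%:R :> R by rewrite ltr0n.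
have [nN1 nN2] : (N1 <= n)%N /\ (N2 <= n)%N.
  by split; apply: leq_trans (ltnW Nn); rewrite ?leq_maxl ?leq_maxr.
have mesh : 2 * L%:num / n%:R < e.
  rewrite ltr_pdivrMr// [ltRHS]mulrC -ltr_pdivrMr// (lt_le_trans HN2)//.
  by rewrite ler_nat.
apply: rescaled_energy_ge => //; apply: le_ereal_inf_tmp => _ [sg ysg <-].
rewrite lee_fin.
have [i [m [i_n si]]] := decomposition_locate s n0 ysg mesh.
have [j [k [j_n tj]]] := decomposition_locate t n0 ysg mesh.
have near_x u v (q : int) : `|u + q%:~R * L%:num - v| < e ->
    enorm (y u - x v) <= C1dist x y + e /\
    enorm (derive1 y u - derive1 x v) <= C1dist x y + C * e.
  move=> uv; rewrite -(curve_periodicz y q u) -(derive1_periodicz y q u).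
  move: (u + _) uv => w wv; have [h1 h2] := C1dist_ge x y w.
  split.
    apply: (le_trans (enorm_triangleB (x w) _ _)); apply: lerD.
      by rewrite enormB; exact: h1.
    exact: (le_trans (arclength_increment_le v w xC) (ltW wv)).
  apply: (le_trans (enorm_triangleB (derive1 x w) _ _)); apply: lerD.
    by rewrite enormB; exact: h2.
  exact: (le_trans (dxC w v) (ler_wpM2l C0 (ltW wv))).
have [ys _] := near_x _ _ _ si; have [yt dyt] := near_x _ _ _ tj.
have big : K' * enorm (y (sg i) - y (sg j)) ^+ 2 <
    2 * dist_line (y (sg j)) (derive1 y (sg j)) (y (sg i)).
  have Ce := mulr_ge0 C0 (ltW e_gt0).
  apply: He; first exact: curve_arclength.
    have -> : y (sg i) - y (sg j) - (x s - x t) = (y (sg i) - x s) - (y (sg j) - x t).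
      by apply/rowP => l; rewrite !mxE; ring.
    apply: (le_lt_trans (enorm_triangle _ _)); rewrite enormN.
    by clear -ys yt xy eE Ce e_gt0; lra.
  by clear -dyt xy eE Ce e_gt0; lra.
have ij : i != j.
  apply/eqP => ij; move: big; rewrite ij.
  rewrite dist_lineE ?curve_arclength// subrr enorm0 !dotv0l expr0n subrr sqrtr0.
  by rewrite !mulr0 ltxx.
apply: (le_trans _ (tp_sum_ge n0 ysg K'0 i_n j_n ij big)).
have := HN1 n nN1; rewrite -/K' => h1.
have -> : (L%:num / (2 * n%:R)) ^+ 2 = L%:num ^+ 2 / (4 * n%:R ^+ 2).
  by field; rewrite gt_eqF.
have n4 : 0 < 4 * n%:R ^+ 2 :> R by rewrite mulr_gt0// exprn_gt0.
rewrite [leRHS]mulrA ler_pdivlMr// mulrAC ler_wpM2r ?sqr_ge0//.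
by rewrite mulrC.
Qed.

Lemma tp_energy_ge0 n (q : R) y : (0 <= tp_energy n q y)%E.
Proof.
apply: le_ereal_inf_tmp => _ [sg [_ sglt _ _] <-]; rewrite lee_fin.
apply: sumr_ge0 => i _; apply: sumr_ge0 => j _.
by rewrite !mulr_ge0 ?powR_ge0// subr_ge0 ltW// sglt.
Qed.

(** Under dilation by s the tangent-point quotient scales like a curvature, by 1/s; the products of
    weights, once the diagonal is included, sum to L^2. *)
Lemma energy_upper x y n K (s h : R) sg : (0 < n)%N -> 0 < K -> 0 < s ->
  tp_le x K -> biarc_decomposition n y sg ->
  (forall i, (i < n)%N -> y (sg i) = s *: x (i%:R * h) /\
     derive1 y (sg i) = derive1 x (i%:R * h)) ->
  ((L%:num `^ ((n%:R - 2) / n%:R))%:E * tp_energy n n%:R y `^ (n%:R^-1)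
    <= (L%:num * (K / s))%:E)%E.
Proof.
move=> n0 K0 s0 xK ysg yx; have Ks : 0 < K / s by rewrite divr_gt0.
apply: rescaled_energy_le => //; first exact: tp_energy_ge0.
apply: (le_trans (tp_energy_le _ ysg)); rewrite lee_fin.
have [sgn sglt _ _] := ysg.
have len_ge0 i : (i < n)%N -> 0 <= sg i.+1 - sg i by move=> /sglt /ltW; rewrite subr_ge0.
have quot i j : (i < n)%N -> (j < n)%N ->
   0 <= 2 * dist_line (y (sg j)) (derive1 y (sg j)) (y (sg i))
       / enorm (y (sg i) - y (sg j)) ^+ 2 <= K / s.
  move=> i_n j_n; have [-> _] := yx i i_n; have [-> ->] := yx j j_n.
  set u := i%:R * h; set v := j%:R * h.
  have dE : dist_line (s *: x v) (derive1 x v) (s *: x u) =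
      s * dist_line (x v) (derive1 x v) (x u).
    rewrite !dist_lineE ?curve_arclength// -scalerBr; move: (x u - x v) => P.
    rewrite !dotv_lin (_ : _ - _ = s ^+ 2 * (dotv P P - dotv P (derive1 x v) ^+ 2)).
      by rewrite sqrtrM ?sqr_ge0// sqrtr_sqr gtr0_norm.
    by ring.
  rewrite dE -scalerBr enormZ (gtr0_norm s0).
  have d0 := dist_line_ge0 (x v) (x u) (curve_arclength x v).
  have xKuv := xK u v.
  (* If the points coincide, in particular for i = j, division by zero makes the quotient 0. *)
  have := enorm_ge0 (x u - x v); rewrite le_eqVlt => /orP[/eqP <-|P0].
    by rewrite mulr0 expr0n invr0 mulr0 lexx ltW.
  apply/andP; split.
    apply: divr_ge0; last exact: sqr_ge0.
    by apply: mulr_ge0; [exact: ler0n|apply: mulr_ge0; [exact: ltW|exact: d0]].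
  rewrite ler_pdivrMr; last by rewrite exprn_gt0// mulr_gt0.
  have -> : K / s * (s * enorm (x u - x v)) ^+ 2 = s * (K * enorm (x u - x v) ^+ 2).
    by field; rewrite gt_eqF.
  by rewrite mulrCA ler_pM2l.
have lenL : \sum_(i < n) (sg i.+1 - sg i) = L%:num.
  rewrite -(big_mkord xpredT (fun i => sg i.+1 - sg i)) telescope_sumr//.
  by rewrite sgn addrAC subrr add0r.
rewrite -{1}lenL expr2 {1}lenL mulrA mulr_sumr /tp_sum.
apply: ler_sum => i _.
apply: (@le_trans _ _ (\sum_(j < n) (K / s) ^+ n * (sg i.+1 - sg i) * (sg j.+1 - sg j))).
  rewrite [leRHS](bigID (fun j : 'I_n => j != i)) /= -[leLHS]addr0; apply: lerD.
    apply: ler_sum => j _; apply: ler_wpM2r; first exact: len_ge0.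
    apply: ler_wpM2r; first exact: len_ge0.
    have /andP[q0 qK] := quot i j (ltn_ord i) (ltn_ord j).
    by rewrite powR_mulrn//; apply: lerXn2r => //; rewrite nnegrE ltW.
  apply: sumr_ge0 => j _; apply: mulr_ge0; last exact: len_ge0.
  by apply: mulr_ge0; [rewrite exprn_ge0// ltW|exact: len_ge0].
by rewrite -mulr_sumr lenL; rewrite -!mulrA (mulrC L%:num).
Qed.

End GammaBounds.

Theorem theorem1p3 (R : realType) (L : {posnum R}) :
  @Gamma_converges R (C11ia L)
    (fun (n : nat) (gamma : C11ia L) =>
       ((L%:num `^ ((n%:R - 2) / n%:R))%:E
        * tp_energy n n%:R gamma `^ (n%:R^-1))%E)
    (fun gamma : C11ia L => ropelength gamma).
Proof.
have L0 : 0 < L%:num by [].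
split=> [x_ x xx|x].
  apply: le_ereal_pos.
    apply: limn_einf_ge; apply: nearW => n.
    by apply: mule_ge0; [rewrite lee_fin powR_ge0|exact: poweR_ge0].
  move=> r r0 rx; pose K := r / L%:num.
  have K0 : 0 < K by rewrite divr_gt0.
  have rE : r = L%:num * K by rewrite mulrC divfK// gt_eqF.
  have nx : ~ tp_le x K.
    move=> /(tp_le_thickness K0) /(ropelength_leP _ K0).2.
    by rewrite -rE leNgt rx.
  have [e e0 [N HN]] := energy_liminf K0 nx.
  apply: limn_einf_ge; rewrite rE.
  have [N' _ HN'] := (cvg_ballP _ _).1 xx e e0.
  exists (maxn N N') => // n /= Nn; apply: HN.
    exact: leq_trans (leq_maxl _ _) Nn.
  have := HN' n (leq_trans (leq_maxr _ _) Nn).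
  by rewrite /= ballEmdist.
have [xoo|xoo] := eqVneq (ropelength x) +oo%E.
  by exists (fun=> x); [exact: cvg_cst|rewrite xoo leey].
have rope0 : (0 <= ropelength x)%E.
  apply: mule_ge0; first by rewrite lee_fin ltW.
  by rewrite inve_ge0 thickness_ge0.
have [rho rhoE] : exists rho, ropelength x = rho%:E.
  by move: xoo rope0; case: (ropelength x) => // rho _ _; exists rho.
have rho0 : 0 <= rho by move: rope0; rewrite rhoE lee_fin.
have tpK K : 0 < K -> rho <= L%:num * K -> tp_le x K.
  move=> K0 rK; apply: thickness_tp_le => //.
  by apply/(ropelength_leP _ K0); rewrite rhoE lee_fin.
(* The sequence is built once from this crude constant, positive even if [rho = 0]. The sharp
   constant depends on the tolerance [e] and enters only in the energy estimate. *)
pose K0 := rho / L%:num + 1.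
have K00 : 0 < K0 by rewrite ltr_wpDl// divr_ge0// ltW.
have xK0 : tp_le x K0.
  apply: tpK => //; rewrite /K0 mulrDr mulr1 mulrC divfK ?gt_eqF//.
  by rewrite lerDl ltW.
have [M [h0 [M0 h00 Hrec]]] := recovery_curve K00 xK0.
(* [x] itself fills in for n = 0 and for the finitely many n with too coarse a mesh. *)
have /choice[y_ Hy] : forall n : nat, exists y : C11ia L,
    (0 < n)%N -> L%:num / n%:R <= h0 -> exists (s : R) (sg : nat -> R),
    [/\ C1dist x y <= M * (L%:num / n%:R), `|s - 1| <= M * (L%:num / n%:R),
        0 < s, biarc_decomposition n y sg &
        forall i, (i < n)%N -> y (sg i) = s *: x (i%:R * (L%:num / n%:R)) /\
          derive1 y (sg i) = derive1 x (i%:R * (L%:num / n%:R))].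
  move=> n; have [n0|n0] := boolP (0 < n)%N; last by exists x.
  have [nh|nh] := boolP (L%:num / n%:R <= h0); last by exists x.
  by have [y [s [sg H]]] := Hrec n n0 nh; exists y => _ _; exists s, sg.
have small (d : R) : 0 < d -> \forall n \near \oo, (0 < n)%N /\ L%:num / n%:R <= d.
  move=> d0; exists (Num.bound (L%:num / d)).+1 => // n /= Nn.
  have n0 : (0 < n)%N by apply: leq_trans Nn.
  split => //; rewrite ler_pdivrMr ?ltr0n// [leRHS]mulrC -ler_pdivrMr//.
  apply: (le_trans (ltW (archi_boundP (divr_ge0 (ltW L0) (ltW d0))))).
  by rewrite ler_nat ltnW.
have M1 : 0 < M + 1 by rewrite ltr_wpDl.
have Msmall (d h : R) : 0 < d -> 0 < h -> h <= d / (M + 1) -> M * h < d.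
  move=> d0 h1; rewrite ler_pdivlMr// => hd; clear -hd h1; lra.
exists y_.
  apply/cvg_ballP => e e0; have d0 : 0 < Num.min h0 (e / (M + 1)).
    by rewrite lt_min h00 divr_gt0.
  apply: filterS (small _ d0) => n [n0]; rewrite le_min => /andP[nh ne].
  have [s [sg [H _ _ _ _]]] := Hy n n0 nh.
  rewrite ballEmdist /=; apply: (le_lt_trans H); apply: Msmall => //.
  by rewrite divr_gt0// ltr0n.
apply/lee_addgt0Pr => e e0; rewrite rhoE -EFinD.
(* The gap between [K] and [K1] absorbs the dilation: eventually s >= 1 - M L / n > K / K1, so K / s
   stays below K1. *)
pose K := (rho + e / 2) / L%:num; pose K1 := (rho + e) / L%:num.
have Kpos : 0 < K by rewrite divr_gt0// ltr_wpDl// divr_gt0.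
have K1pos : 0 < K1 by rewrite divr_gt0// ltr_wpDl.
have KK1 : K < K1 by rewrite ltr_pM2r ?invr_gt0// ltrD2l; clear -e0; lra.
have LK1 : L%:num * K1 = rho + e by rewrite mulrC divfK// gt_eqF.
have xK : tp_le x K.
  apply: tpK => //; rewrite mulrC divfK ?gt_eqF// lerDl.
  by rewrite ltW// divr_gt0.
have q1 : 0 < 1 - K / K1 by rewrite subr_gt0 ltr_pdivrMr// mul1r.
have d0 : 0 < Num.min h0 ((1 - K / K1) / (M + 1)).
  by rewrite lt_min h00 divr_gt0.
apply: limn_esup_le; apply: filterS (small _ d0) => n [n0].
rewrite le_min => /andP[nh nq]; have [s [sg [_ sM s0 ysg yx]]] := Hy n n0 nh.
apply: (le_trans (energy_upper n0 Kpos s0 xK ysg yx)).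
rewrite lee_fin -LK1 ler_pM2l// ler_pdivrMr// mulrC -ler_pdivrMr//.
have h1 : 0 < L%:num / n%:R by rewrite divr_gt0// ltr0n.
have := Msmall _ _ q1 h1 nq.
by move: sM; rewrite ler_norml => /andP[]; clear; lra.
Qed.
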